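(* Let $R$ be a Noetherian commutative ring, and let $V$ be a finitely generated $VIC(\mathbb{Z})$-module over $R$ which is pointwise finitely generated over $R$ and pointwise of finite type. Then any $VIC(\mathbb{Z})$-submodule $W\subseteq V$ is finitely generated.
   Context: $VIC(\mathbb{Z})$ is the category whose objects are the free $\mathbb{Z}$-modules of finite rank at least $3$ and whose morphisms $M \to N$ are split injections, i.e. pairs $(f,g)$ of linear maps $f: M\to N$, $g: N \to M$ with $g\circ f = \mathrm{id}_M$. A $VIC(\mathbb{Z})$-module over $R$ is a functor $V$ from $VIC(\mathbb{Z})$ to $R$-modules; write $V_n = V(\mathbb{Z}^n)$ ($n\ge3$), a representation of $GL_n(\mathbb{Z})$ over $R$. A submodule is a subfunctor (of $R$-modules). $V$ is finitely generated if there are finitely many elements $v_j \in V(X_j)$ such that every element of every $V(X)$ is an $R$-linear combination of images of the $v_j$ under maps induced by morphisms $X_j \to X$. $V$ is pointwise finitely generated over $R$ if every $V_n$ is a finitely generated $R$-module, and pointwise of finite type if for every $n$ the action of $GL_n(\mathbb{Z})$ on $V_n$ factors through a finite group. *)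

(* Defs.v *)
From mathcomp Require Import all_boot all_order all_algebra all_fingroup.

Set Implicit Arguments.
Unset Strict Implicit.
Unset Printing Implicit Defensive.

Import GRing.Theory.
Local Open Scope ring_scope.

(* Submodules and ideals are Prop-valued, so that they are not restricted to
   the decidable ones. *)
Definition is_submod (R : pzRingType) (M : lmodType R) (S : M -> Prop) : Prop :=
  S 0 /\ forall (a : R) (x y : M), S x -> S y -> S (a *: x + y).

Definition fg_submod (R : pzRingType) (M : lmodType R) (S : M -> Prop) : Prop :=
  exists (k : nat) (v : 'I_k -> M),
    (forall i, S (v i)) /\
    forall x, S x -> exists c : 'I_k -> R, x = \sum_(i < k) c i *: v i.

Definition noetherian (R : comPzRingType) : Prop :=
  forall I : R^o -> Prop, is_submod I -> fg_submod I.

(* A vectType int is a Z-module linearly isomorphic to 'rV[int]_(dim M), that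
   is, a free Z-module of rank dim M; 'Hom(M, N) consists of all the Z-linear
   maps M -> N and ignores the coordinates. *)
Record vic_obj := VicObj {
  vic_mod :> vectType int;
  vic_rank : (3 <= dim vic_mod)%N
}.

Record vic_hom (M N : vic_obj) := VicHom {
  vic_inj : 'Hom(M, N);
  vic_ret : 'Hom(N, M);
  vic_retK : (vic_ret \o vic_inj = \1)%VF
}.

Definition vic_id (M : vic_obj) : vic_hom M M :=
  VicHom (comp_lfun1l (\1 : 'End(M))%VF).

Lemma vic_comp_subproof (M N P : vic_obj) (g : vic_hom N P) (f : vic_hom M N) :
  ((vic_ret f \o vic_ret g) \o (vic_inj g \o vic_inj f) = \1)%VF.
Proof.
by rewrite comp_lfunA -(comp_lfunA (vic_ret f)) vic_retK comp_lfun1r vic_retK.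
Qed.

Definition vic_comp (M N P : vic_obj) (g : vic_hom N P) (f : vic_hom M N) :
  vic_hom M P := VicHom (vic_comp_subproof g f).

Record vic_module (R : pzRingType) := VicModule {
  vic_val :> vic_obj -> lmodType R;
  vic_map : forall M N : vic_obj, vic_hom M N -> {linear vic_val M -> vic_val N};
  vic_map_id : forall (M : vic_obj) (x : vic_val M), vic_map (vic_id M) x = x;
  vic_map_comp : forall (M N P : vic_obj) (g : vic_hom N P) (f : vic_hom M N)
    (x : vic_val M), vic_map (vic_comp g f) x = vic_map g (vic_map f x)
}.

Record vic_submodule (R : pzRingType) (V : vic_module R) := VicSubmodule {
  vic_mem :> forall M : vic_obj, V M -> Prop;
  vic_mem_submod : forall M : vic_obj, is_submod (@vic_mem M);
  vic_mem_map : forall (M N : vic_obj) (f : vic_hom M N) (x : V M),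
    vic_mem x -> vic_mem (vic_map V f x)
}.

Lemma vic_full_submod (R : pzRingType) (V : vic_module R) (M : vic_obj) :
  is_submod (fun _ : V M => True).
Proof. by []. Qed.

Definition vic_full (R : pzRingType) (V : vic_module R) : vic_submodule V :=
  VicSubmodule (@vic_full_submod R V) (fun _ _ _ _ _ => I).

Definition fg_vic_submodule (R : pzRingType) (V : vic_module R)
    (W : vic_submodule V) : Prop :=
  exists (k : nat) (X : 'I_k -> vic_obj) (v : forall j, V (X j)),
    (forall j, W (X j) (v j)) /\
    forall (M : vic_obj) (x : V M), W M x ->
      exists (n : nat) (c : 'I_n -> R) (j : 'I_n -> 'I_k)
             (f : forall i, vic_hom (X (j i)) M),
        x = \sum_(i < n) c i *: vic_map V (f i) (v (j i)).

Definition fg_vic_module (R : pzRingType) (V : vic_module R) : Prop :=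
  fg_vic_submodule (vic_full V).

(* Z^n is realised by column vectors so that matrices act on the left. *)
Lemma vic_Zn_subproof (n : nat) : (3 <= n)%N -> (3 <= dim 'cV[int]_n)%N.
Proof. by rewrite dim_matrix mulr1. Qed.

Definition vic_Zn (n : nat) (n_ge3 : (3 <= n)%N) : vic_obj :=
  VicObj (vic_Zn_subproof n_ge3).

Lemma vic_GL_subproof (n : nat) (A : 'M[int]_n) : A \in unitmx ->
  (linfun (mulmx (invmx A)) \o linfun (mulmx A) =
     \1 :> 'End('cV[int]_n))%VF.
Proof.
by move=> uA; apply/lfunP=> x; rewrite comp_lfunE id_lfunE !lfunE /= mulKmx.
Qed.

(* A \in GL_n(Z) as the morphism (A, A^-1) of VIC(Z). *)
Definition vic_GL (n : nat) (n_ge3 : (3 <= n)%N) (A : 'M[int]_n)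
    (uA : A \in unitmx) : vic_hom (vic_Zn n_ge3) (vic_Zn n_ge3) :=
  @VicHom (vic_Zn n_ge3) (vic_Zn n_ge3) _ _ (vic_GL_subproof uA).

Definition pointwise_fg (R : pzRingType) (V : vic_module R) : Prop :=
  forall (n : nat) (n_ge3 : (3 <= n)%N),
    fg_submod (fun _ : V (vic_Zn n_ge3) => True).

(* GL_n(Z) is the set of A : 'M[int]_n with A \in unitmx; the action on V_n is
   the composite of a group morphism phi from GL_n(Z) to a finite group G and
   of an R-linear action psi of G on V_n. Values of phi outside GL_n(Z) are
   irrelevant. *)
Definition pointwise_finite_type (R : pzRingType) (V : vic_module R) : Prop :=
  forall (n : nat) (n_ge3 : (3 <= n)%N),
    exists (G : finGroupType) (phi : 'M[int]_n -> G)
           (psi : G -> {linear V (vic_Zn n_ge3) -> V (vic_Zn n_ge3)}),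
      [/\ {in unitmx &, {morph phi : A B / A *m B >-> (A * B)%g}},
          forall x, psi 1%g x = x,
          forall g h x, psi (g * h)%g x = psi g (psi h x)
        & forall (A : 'M[int]_n) (uA : A \in unitmx) x,
            vic_map V (vic_GL n_ge3 uA) x = psi (phi A) x].

(* Main.v *)
From HB Require Import structures.
From Stdlib Require List.
Require Import Defs.
From mathcomp Require Import all_boot all_order all_algebra all_fingroup cyclic zify.
From mathcomp.classical Require Import boolp.

(** Write [Z^d -> Z^n] for a split injection [(f, g)], seen as an integer
    matrix [F] with [n] rows and a retraction [G] with [n] columns.  Complements
    of split injections are free, so there are a rank [d] and finitely many
    [v_j] in [V_d] such that each [V_n] with [n >= d] is spanned by the [h v_j],
    where [h : Z^d -> Z^n] ([fg_common_rank]).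

    The number of vectors [h v_j] is first made finite, with a bound on the
    level that is uniform in [n].  In rank [d + 1] a finite group acts, so some
    [l > 0] is such that the transvections mixing the last coordinate with the
    first [d] ones, with entries divisible by [l], fix the image of [V_d].  A
    block unipotent matrix in rank [d + m] is a product of [m] matrices, each of
    which is such a transvection up to an inclusion [Z^(d+1) -> Z^(d+m)]; hence
    the same [l] works for all [m] ([finite_type_fixed_by_unipotents]).
    Matrix reduction with these unipotents and with [GL_m(Z)] then shows that,
    for [n >= 3 d], the vector [h v_j] only depends on [h] modulo [N = l ^ 2]
    ([congruent_act]).

    So [h v_j] is named by [j] and by a word of length [n] over the finite
    alphabet [(Z/N)^d * (Z/N)^d], the [s]-th letter being the [s]-th row of [F]
    together with the [s]-th column of [G], modulo [N].  Let [p] be a surjection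
    from [m] positions to [n] positions, all of whose fibres have size 1 modulo
    [N].  Modulo [N], the matrix of [p] is a split injection whose retraction is
    its transpose, and it lifts to [Z^n -> Z^m] over the integers
    ([copy_injK]).  Composition with it copies letters: it turns the word [w]
    into the word [w o p] ([word_copy]).  If the first occurrences of the values
    of [p] come in increasing order, this is strictly increasing for the
    lexicographic order ([lexval_pullback]).

    The theorem now follows as Hilbert's basis theorem does, by Groebner bases
    ([groebner_fg]).  To a word one attaches the ideal of the leading
    coefficients of the elements of [W] whose leading term is that word; these
    ideals grow along copying maps.  As [R] is noetherian, it remains to see
    that among infinitely many words one is obtained from an earlier one by
    copying letters.  This is Higman's lemma ([higman]), applied to words in
    which every letter carries the set of letters read before it, so that an
    inserted letter always has an earlier letter to be copied from
    ([marked_pullback]).  The finitely many ranks below [3 d] are dealt with by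
    the noetherian module [V_n]. *)

Set Implicit Arguments.
Unset Strict Implicit.
Unset Printing Implicit Defensive.

Import GRing.Theory VectorInternalTheory.

(** * Well-quasi-orders and words *)

Definition wqo (T : Type) (r : T -> T -> Prop) : Prop :=
  forall f : nat -> T, exists i j, (i < j)%N /\ r (f i) (f j).

Definition increasing (g : nat -> nat) := forall i j, (i < j)%N -> (g i < g j)%N.

Lemma infinite_enum (P : nat -> Prop) :
  (forall n, exists2 m, (n <= m)%N & P m) ->
  exists2 g, increasing g & forall i, P (g i).
Proof.
move=> infP.
have [nx nxP] : {nx & forall n, (n <= nx n)%N /\ P (nx n)}.
  by apply: (choice (P := fun n m => (n <= m)%N /\ P m)) => n;
     have [m] := infP n; exists m.
pose g := fix g i := if i is i'.+1 then nx (g i').+1 else nx 0.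
exists g; last by case=> [|i] /=; apply: (nxP _).2.
have gS i : (g i < g i.+1)%N by apply: (nxP _).1.
by move=> i j; apply: (homo_ltn (f := g) (r := fun x y => (x < y)%N)) => // ?; apply: ltn_trans.
Qed.

(** Only finitely many terms of a sequence are below none of the later ones,
    since such terms would form a sequence contradicting [wqo]; beyond them a
    chain can always be continued. *)
Lemma wqo_increasing (T : Type) (r : T -> T -> Prop) :
  wqo r -> (forall x y z, r x y -> r y z -> r x z) ->
  forall f : nat -> T,
    exists2 g, increasing g & forall i j, (i < j)%N -> r (f (g i)) (f (g j)).
Proof.
move=> wr tr f.
pose isolated i := forall j, (i < j)%N -> ~ r (f i) (f j).
have [b bP] : exists b, forall i, (b <= i)%N -> ~ isolated i.
  apply: contrapT => nob.
  have [g gI gP] : exists2 g, increasing g & forall i, isolated (g i).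
    apply: infinite_enum => n; apply: contrapT => noi; apply: nob.
    by exists n => i ni iso; apply: noi; exists i.
  have [i [j [ij rij]]] := wr (f \o g).
  exact: gP i _ (gI _ _ ij) rij.
have [nx nxP] : {nx & forall i, (b <= i)%N ->
    (i < nx i)%N /\ r (f i) (f (nx i))}.
  apply: (choice (P := fun i j => (b <= i)%N -> (i < j)%N /\ r (f i) (f j))).
  move=> i; have [bi|_] := boolP (b <= i)%N; last by exists 0.
  apply: contrapT => noj; apply: (bP i bi) => j ij rij.
  by apply: noj; exists j.
pose g i := iter i nx b.
have gb i : (b <= g i)%N.
  elim: i => //= i IHi; apply: leq_trans (IHi) _.
  by apply: ltnW; apply: (nxP _ IHi).1.
exists g.
  move=> i j; apply: (homo_ltn (f := g) (r := fun x y => (x < y)%N)) => {i j} [|i].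
    by move=> ?; apply: ltn_trans.
  by apply: (nxP _ (gb i)).1.
move=> i j; apply: (homo_ltn (r := fun x y => r (f x) (f y))) => {i j} [|i].
  by move=> x y z; apply: tr.
by apply: (nxP _ (gb i)).2.
Qed.

Lemma infinite_pigeonhole (D : finType) (f : nat -> D) :
  exists a, forall n, exists2 m, (n <= m)%N & f m = a.
Proof.
apply: contrapT => noa.
have [b bP] : {b : D -> nat & forall a m, f m = a -> (m < b a)%N}.
  apply: (choice (P := fun a n => forall m, f m = a -> (m < n)%N)) => a.
  apply: contrapT => non; apply: noa; exists a => n.
  apply: contrapT => nom; apply: non; exists n => m fm.
  by rewrite ltnNge; apply/negP => nm; apply: nom; exists m.
have := bP _ (\max_a b a) erefl.
by rewrite ltnNge (bigmax_sup (f (\max_a b a))).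
Qed.

(** Nash-Williams' argument.  From a bad sequence one builds a bad sequence [g]
    each of whose words has minimal length given the words before it.
    Infinitely many words of [g] start with the same letter; removing it from
    them, and dropping the other words from the first of them on, gives a bad
    sequence that contradicts minimality. *)
Theorem higman (D : finType) : wqo (fun x y : seq D => subseq x y).
Proof.
pose bad (f : nat -> seq D) := forall i j, (i < j)%N -> ~~ subseq (f i) (f j).
suff nobad f : ~ bad f.
  move=> f; apply: contrapT => nogood; apply: (nobad f) => i j ij.
  by apply/negP => fij; apply: nogood; exists i, j.
move=> badf.
pose ext (l : seq (seq D)) :=
  exists2 f, bad f & forall i, (i < size l)%N -> f i = nth [::] l i.
have [nx nxP] : {nx & forall l, ext l -> ext (rcons l (nx l)) /\
    forall y, ext (rcons l y) -> (size (nx l) <= size y)%N}.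
  apply: (choice (P := fun l x => ext l -> ext (rcons l x) /\
    forall y, ext (rcons l y) -> (size x <= size y)%N)) => l.
  have [extl|] := pselect (ext l); last by exists [::].
  have exs : exists n, `[< exists2 x, ext (rcons l x) & size x = n >].
    have [h badh hl] := extl.
    exists (size (h (size l))); apply/asboolP; exists (h (size l)) => //.
    exists h => // i; rewrite size_rcons ltnS leq_eqVlt nth_rcons => /orP[/eqP->|il].
      by rewrite ltnn eqxx.
    by rewrite il hl.
  have [n /asboolP[x extx <-] nmin] := ex_minnP exs.
  exists x => _; split=> // y exty; apply: nmin; apply/asboolP; by exists y.
pose L n := iter n (fun l => rcons l (nx l)) [::].
pose g n := nx (L n).
have LS n : L n.+1 = rcons (L n) (g n) by [].
have sL n : size (L n) = n by elim: n => // n IHn; rewrite LS size_rcons IHn.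
have extL n : ext (L n).
  elim: n => [|n IHn]; first by exists f.
  by rewrite LS; have [] := nxP _ IHn.
have nthL n i : (i < n)%N -> nth [::] (L n) i = g i.
  elim: n => // n IHn; rewrite ltnS leq_eqVlt LS nth_rcons sL => /orP[/eqP->|i_n].
    by rewrite ltnn eqxx.
  by rewrite i_n IHn.
have gmin n y : ext (rcons (L n) y) -> (size (g n) <= size y)%N.
  by have [_] := nxP _ (extL n); apply.
have badg : bad g.
  move=> i j ij; have [h badh hL] := extL j.+1.
  rewrite sL in hL.
  have gh k : (k < j.+1)%N -> g k = h k by move=> kj; rewrite hL ?nthL.
  by rewrite !gh ?(ltn_trans ij) // badh.
have gn0 n : g n != [::].
  by apply/eqP => gn; have := badg n n.+1 (ltnSn n); rewrite gn sub0seq.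
have [a infa] := infinite_pigeonhole (fun n => ohead (g n)).
have [s sI sa] := infinite_enum infa.
pose h k := if (k < s 0)%N then g k else behead (g (s (k - s 0))).
have [c ac] : exists c, a = Some c.
  by rewrite -(sa 0); case: (g (s 0)) (gn0 (s 0)) => // c w _; exists c.
have gs i : g (s i) = c :: behead (g (s i)).
  by have := sa i; rewrite ac; case: (g (s i)) => //= b w [->].
have s0 i : (s 0 <= s i)%N by case: i => // i; apply/ltnW/sI.
have badh : bad h.
  move=> i j ij; rewrite /h.
  have [js|sj] := ltnP j (s 0); first by rewrite (ltn_trans ij js) badg.
  have [i_s|si] := ltnP i (s 0).
    have := badg _ _ (leq_trans i_s (s0 (j - s 0))).
    rewrite [X in subseq _ X]gs; apply: contra => sub.
    exact: subseq_trans sub (subseq_cons _ _).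
  have ij' : (i - s 0 < j - s 0)%N by rewrite ltn_sub2r // (leq_ltn_trans si).
  have := badg _ _ (sI _ _ ij').
  by rewrite [X in subseq X _]gs [X in subseq _ X]gs /= eqxx.
suff: (size (g (s 0)) <= size (behead (g (s 0))))%N by rewrite {1}gs ltnn.
apply: gmin.
exists h => // i; rewrite size_rcons sL ltnS leq_eqVlt nth_rcons sL /h.
by case/orP=> [/eqP->|is0]; rewrite ?ltnn ?eqxx ?subnn // is0 nthL.
Qed.

(** * Copying letters of a word *)

(** Restricted growth sequences: [p] takes values below [n], the values below
    [k] have already occurred, and each other value occurs for the first time
    after all the smaller ones.  For [k = 0] these are the surjections onto
    [n] positions whose first occurrences increase. *)
Fixpoint rgs (k n : nat) (p : seq nat) : bool :=
  if p is i :: p' then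
    (i < k) && rgs k n p' || (i == k) && rgs k.+1 n p'
  else k == n.

Lemma rgs_leq k n p : rgs k n p -> k <= n.
Proof.
elim: p k => [|i p IHp] k /=; first by move/eqP->.
by case/orP=> /andP[_ /IHp] // /ltnW.
Qed.

Lemma rgs_bound k n p i : rgs k n p -> i \in p -> i < n.
Proof.
elim: p k => // a p IHp k /=; rewrite inE => /orP[]/andP[ak pP] /orP[/eqP->|];
  try by apply: IHp pP.
  exact: leq_trans ak (rgs_leq pP).
by rewrite (eqP ak) (rgs_leq pP).
Qed.

Lemma rgs_mem k n p i : rgs k n p -> k <= i -> i < n -> i \in p.
Proof.
elim: p k => [|a p IHp] k /=; first by move/eqP->; rewrite leqNgt => /negP.
case/orP=> /andP[ak pP] ki i_n; rewrite inE; first by rewrite (IHp k) ?orbT.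
move: ki; rewrite leq_eqVlt => /orP[|ki]; first by rewrite eq_sym (eqP ak) => ->.
by rewrite (IHp k.+1) ?orbT.
Qed.

(** Both the value of a word and the rank of a pair of a generator and a word are
    numerals of this form, so that they are compared lexicographically. *)
Lemma digit_lt Q a a' v v' : v < Q -> v' < Q ->
  (a * Q + v < a' * Q + v') = (a < a') || (a == a') && (v < v').
Proof.
move=> vQ v'Q; have mulQ j j' : j < j' -> j * Q + Q <= j' * Q.
  by move=> jj'; rewrite addnC -mulSn leq_mul2r jj' orbT.
case: (ltngtP a a') => [/mulQ|/mulQ|->] /=; last by rewrite ltn_add2l.
  by move: (a * Q) (a' * Q) => b b'; lia.
by move: (a * Q) (a' * Q) => b b'; lia.
Qed.

Lemma digit_inj Q a a' v v' : v < Q -> v' < Q ->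
  a * Q + v = a' * Q + v' -> a = a' /\ v = v'.
Proof.
move=> vQ v'Q eqav; have := digit_lt a a' vQ v'Q; have := digit_lt a' a v'Q vQ.
rewrite eqav ltnn eq_sym; case: ltngtP eqav => //= -> /eqP.
by rewrite eqn_add2l => /eqP.
Qed.

Section Words.
Variable B : finType.
Implicit Types (b : B) (S : {set B}) (u w x y : seq B).

(** The mark of a letter is the set of letters read before it.  When a marked
    letter of [x] is matched with one of [y], all the letters of [y] skipped so
    far have thus been read in [x] as well. *)
Fixpoint marked S w : seq (B * {set B}) :=
  if w is b :: w' then (b, S) :: marked (b |: S) w' else [::].

Lemma mem_marked S w b S' : (b, S') \in marked S w -> S \subset S'.
Proof.
elim: w S => // a w IHw S; rewrite inE => /orP[/eqP[_ ->] //|/IHw].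
exact: subset_trans (subsetUr _ _).
Qed.

(** The word [u] is what has been matched already.  A letter of [y] that is not
    matched is copied from its first occurrence in [u].  Therefore only first
    occurrences acquire additional copies, and their number is the excess of
    that letter in [y] over [x]. *)
Lemma marked_subseq_pullback (b0 : B) u x y :
    subseq (marked [set b in u] x) (marked [set b in u] y) ->
    u ++ x =i u ++ y ->
  exists p, [/\ rgs (size u) (size (u ++ x)) p,
      y = [seq nth b0 (u ++ x) i | i <- p] &
      forall i, i < size (u ++ x) ->
        let b := nth b0 (u ++ x) i in
        count_mem i p + (i == index b (u ++ x)) * count_mem b x =
        (size u <= i) + (i == index b (u ++ x)) * count_mem b y].
Proof.
elim: y u x => [|a y IHy] u x.
  case: x => //= _ _; exists [::]; split; rewrite ?cats0 //= => i i_u.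
  by rewrite leqNgt i_u !muln0.
move=> sub eqS.
have copy : a \in u -> subseq (marked [set b in u] x) (marked [set b in u] y) ->
    exists p, [/\ rgs (size u) (size (u ++ x)) p,
      a :: y = [seq nth b0 (u ++ x) i | i <- p] &
      forall i, i < size (u ++ x) ->
        let b := nth b0 (u ++ x) i in
        count_mem i p + (i == index b (u ++ x)) * count_mem b x =
        (size u <= i) + (i == index b (u ++ x)) * count_mem b (a :: y)].
  move=> au sub'; have [|p [pP yp pc]] := IHy u x sub'.
    by move=> b; rewrite eqS !mem_cat inE; case: eqP => // ->; rewrite au.
  have aux : a \in u ++ x by rewrite mem_cat au.
  have Da : index a (u ++ x) = index a u by rewrite index_cat au.
  exists (index a (u ++ x) :: p); split=> [||i i_ux] /=.
  - by rewrite {1}Da index_mem au pP.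
  - by rewrite nth_index // -yp.
  set b := nth b0 _ i; have := pc i i_ux; rewrite -/b /= => pci.
  rewrite -addnA pci addnCA mulnDr; congr (_ + (_ + _)).
  case: (eqVneq a b) => [->|ab]; first by rewrite muln1 eq_sym.
  by rewrite muln0; apply/eqP; rewrite eqb0; apply: contraNneq ab => Di;
     rewrite /b -Di nth_index.
case: x sub eqS copy => [|c x] sub eqS copy.
  apply: copy; last exact: sub0seq.
  by have := eqS a; rewrite cats0 mem_cat inE eqxx orbT.
have [Dca|nca] := eqVneq (c, [set b in u]) (a, [set b in u]); last first.
  move: sub; rewrite [marked _ (a :: y)]/= [marked _ (c :: x)]/= /=.
  rewrite (negPf nca) => sub.
  have au : a \in u.
    have /(mem_subseq sub)/mem_marked : (c, [set b in u]) \in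
        (c, [set b in u]) :: marked (c |: [set b in u]) x by rewrite inE eqxx.
    by rewrite subUset sub1set inE => /andP[].
  apply: copy => //; congr (subseq _ _): sub; congr (marked _ _).
  by apply/setP => b; rewrite !inE; case: eqP => // ->; rewrite au.
case: Dca eqS sub copy => -> eqS; rewrite /= eqxx => sub _.
have Du : a |: [set b in u] = [set b in rcons u a].
  by apply/setP => b; rewrite !inE mem_rcons inE.
rewrite Du in sub; have [|p] := IHy (rcons u a) x sub.
  by rewrite !cat_rcons.
rewrite cat_rcons size_rcons => -[pP yp pc].
exists (size u :: p); split=> [||i i_ux] /=.
- by rewrite eqxx pP orbT.
- by rewrite nth_cat ltnn subnn -yp.
set b := nth b0 _ i; have := pc i i_ux; rewrite -/b /= !mulnDr.
by rewrite (leq_eqVlt (size u)); case: eqP => [->|] /=; lia.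
Qed.

(** The invariants that must agree for [y] to be a copy of [x]: the letters of
    [y] after the last match have to occur in [x], and the excess counts have to
    vanish modulo [N.+1]. *)
Definition colour (N : nat) w : {set B} * {ffun B -> 'I_N.+1} :=
  ([set b in w], [ffun b => inord (count_mem b w %% N.+1)]).

Lemma marked_pullback (N : nat) (b0 : B) x y :
    subseq (marked set0 x) (marked set0 y) -> colour N x = colour N y ->
  exists p, [/\ rgs 0 (size x) p, y = [seq nth b0 x i | i <- p] &
    forall i, i < size x -> count_mem i p = 1 %[mod N.+1]].
Proof.
move=> sub [eqS eqc]; have S0 : set0 = [set b in [::]] :> {set B}.
  by apply/setP => b; rewrite !inE.
rewrite S0 in sub; have [|p /= [pP yp pc]] := marked_subseq_pullback b0 sub.
  by move=> b; move/setP: eqS => /(_ b); rewrite !inE.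
exists p; split=> // i /pc /(congr1 (modn^~ N.+1)).
set b := nth _ _ _; have : count_mem b x = count_mem b y %[mod N.+1].
  have /(congr1 val) := congr1 (fun f : {ffun _} => f b) eqc.
  by rewrite !ffunE /= !inordK ?ltn_mod.
case: (i == _) => /=; last by rewrite !mul0n !addn0.
rewrite !mul1n => eqxy; rewrite -modnDmr eqxy modnDmr => /eqP.
by rewrite eqn_modDr => /eqP.
Qed.

(** The word as a numeral in base [#|B|]: on words of equal length this is the
    lexicographic order, with values in a well-founded type. *)
Fixpoint lexval w : nat :=
  if w is b :: w' then enum_rank b * #|B| ^ size w' + lexval w' else 0.

Lemma lexval_lt w : lexval w < #|B| ^ size w.
Proof.
elim: w => //= b w IHw; rewrite expnS.
apply: leq_trans (leq_mul (ltn_ord (enum_rank b)) (leqnn _)).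
by rewrite mulSn addnC ltn_add2r.
Qed.

Lemma lexval_cons_lt b w b' w' : size w = size w' ->
  (lexval (b :: w) < lexval (b' :: w')) =
  (enum_rank b < enum_rank b') || (b == b') && (lexval w < lexval w').
Proof.
move=> szw; rewrite /= szw digit_lt ?lexval_lt //; last by rewrite -szw lexval_lt.
by rewrite val_eqE (inj_eq enum_rank_inj).
Qed.

Lemma lexval_inj w w' : size w = size w' -> lexval w = lexval w' -> w = w'.
Proof.
elim: w w' => [|b w IHw] [|b' w'] //= [szw]; rewrite szw.
case/digit_inj; rewrite ?lexval_lt // -?szw ?lexval_lt //.
by move=> /ord_inj/enum_rank_inj -> /(IHw _ szw) ->.
Qed.

Lemma lexval_first_diff (b0 : B) k w w' : size w = size w' -> k < size w ->
    take k w = take k w' -> nth b0 w k != nth b0 w' k ->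
  (lexval w < lexval w') = (enum_rank (nth b0 w k) < enum_rank (nth b0 w' k)).
Proof.
elim: k w w' => [|k IHk] [|b w] [|b' w'] //= [szw] k_w.
  move=> _ nb; have := lexval_cons_lt b b' szw; rewrite /= => ->.
  by rewrite (negPf nb) orbF.
move=> [<- eqt] nb; have := lexval_cons_lt b b szw; rewrite /= => ->.
by rewrite ltnn eqxx IHk.
Qed.

(** Both words of copies agree up to the first copy of the first position where
    the given words differ: by restricted growth, whatever is copied before it
    comes from smaller positions. *)
Lemma lexval_pullback (b0 : B) k p w w' :
    size w = size w' -> rgs k (size w) p -> take k w = take k w' ->
  lexval w < lexval w' ->
  lexval [seq nth b0 w i | i <- p] < lexval [seq nth b0 w' i | i <- p].
Proof.
move=> szw; elim: p k => [|i p IHp] k.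
  move=> /= /eqP->; rewrite take_size szw take_size => ->.
  by rewrite ltnn.
move=> pP eqt ltv; rewrite [X in X < _]/= [X in _ < X]/=.
have szp : size [seq nth b0 w i | i <- p] = size [seq nth b0 w' i | i <- p].
  by rewrite !size_map.
have := lexval_cons_lt (nth b0 w i) (nth b0 w' i) szp; rewrite /= => ->.
case/orP: pP => /andP[ik pP].
  have -> : nth b0 w i = nth b0 w' i by rewrite -(nth_take _ ik) eqt nth_take.
  by rewrite eqxx (IHp _ pP) ?orbT.
have k_w := rgs_leq pP; rewrite {i ik}(eqP ik).
have [eqk|neqk] := eqVneq (nth b0 w k) (nth b0 w' k).
  rewrite (IHp _ pP) ?orbT // !(take_nth b0) -?szw //; congr rcons => //.
by rewrite -(lexval_first_diff szw k_w eqt neqk) ltv.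
Qed.

End Words.

(** * Initial terms over a noetherian ring *)

Local Open Scope ring_scope.

Section Span.
Variables (R : pzRingType) (M : lmodType R).
Implicit Types (P S : M -> Prop) (x y : M).

Inductive span P : M -> Prop :=
| span0 : span P 0
| span_cons a x y : P x -> span P y -> span P (a *: x + y).

Lemma submodD S x y : is_submod S -> S x -> S y -> S (x + y).
Proof. by case=> _ SD Sx Sy; have := SD 1 x y Sx Sy; rewrite scale1r. Qed.

Lemma submodZ S a x : is_submod S -> S x -> S (a *: x).
Proof. by case=> S0 SD Sx; have := SD a x 0 Sx S0; rewrite addr0. Qed.

Lemma submodN S x : is_submod S -> S x -> S (- x).
Proof. by rewrite -scaleN1r; apply: submodZ. Qed.

Lemma span_gen P x : P x -> span P x.
Proof.
by move=> Px; rewrite -[x]addr0 -[x]scale1r; apply: span_cons => //; apply: span0.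
Qed.

Lemma span_submod P : is_submod (span P).
Proof.
split=> [|a x y + Py]; first exact: span0.
elim=> [|b {}x z Px _ IHz]; first by rewrite scaler0 add0r.
by rewrite scalerDr -addrA scalerA; apply: span_cons.
Qed.

Lemma span_min P S x : is_submod S -> (forall y, P y -> S y) -> span P x -> S x.
Proof.
by case=> S0 SD PS; elim=> // a y z /PS Sy _ Sz; apply: SD.
Qed.

Lemma span_mono P P' x : (forall y, P y -> P' y) -> span P x -> span P' x.
Proof.
by move=> PP'; apply: span_min (span_submod _) _ => y /PP'; apply: span_gen.
Qed.

End Span.

Lemma span_linear (R : pzRingType) (M N : lmodType R) (phi : {linear M -> N})
    (P : M -> Prop) (Q : N -> Prop) x :
  (forall y, P y -> Q (phi y)) -> span P x -> span Q (phi x).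
Proof.
move=> PQ; elim=> [|a y z Py _ Qz]; first by rewrite linear0; apply: span0.
by rewrite linearP; apply: span_cons Qz; apply: PQ.
Qed.

(** The union of the ideals generated by the initial segments is generated by
    finitely many elements, hence by one of these segments. *)
Lemma noetherian_sequence (R : comPzRingType) : noetherian R ->
  forall a : nat -> R^o,
    exists n, span (fun x => exists2 i, (i < n)%N & x = a i) (a n).
Proof.
move=> noethR a.
pose U n := span (fun x => exists2 i, (i < n)%N & x = a i).
have Umono m n x : (m <= n)%N -> U m x -> U n x.
  move=> mn; apply: span_mono => _ [i im ->]; exists i => //.
  exact: leq_trans mn.
have subU : is_submod (fun x => exists n, U n x).
  split=> [|b x y [m Ux] [n Uy]]; first by exists 0%N; apply: span0.
  exists (maxn m n); apply: (span_submod _).2.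
    exact: Umono (leq_maxl _ _) Ux.
  exact: Umono (leq_maxr _ _) Uy.
have [k [v [vU vgen]]] := noethR _ subU.
have [n nP] := choice vU.
exists (\max_i n i).
have [|c ->] := vgen (a (\max_i n i)).
  by exists (\max_i n i).+1; apply: span_gen; exists (\max_i n i).
apply: (big_ind (U _)) => [|x y|i _]; first exact: span0.
  exact: submodD (span_submod _).
apply: submodZ (span_submod _) _.
exact: Umono (leq_bigmax i) (nP i).
Qed.

(** The modules [V n] are spanned by monomials [ev t], which [rank] orders within
    each [n].  The relation [below] is divisibility: it is realised by an
    admissible linear map that sends one monomial to the other and preserves
    strict inequalities between monomials. *)
Section Groebner.
Variables (R : comPzRingType) (noethR : noetherian R).
Variables (D : Type) (V : D -> lmodType R).
Variable adm : forall m n : D, (V m -> V n) -> Prop.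
Variables (T : D -> Type) (ev : forall n, T n -> V n) (rank : forall n, T n -> nat).
Variable below : {n & T n} -> {n & T n} -> Prop.

Definition stable_family (S : forall n, V n -> Prop) : Prop :=
  (forall n, is_submod (@S n)) /\
  forall m n (phi : V m -> V n), adm phi -> forall x, S m x -> S n (phi x).

(** Generation by the list [L] under admissible maps is expressed by quantifying
    over the stable families that contain [L], which avoids linear
    combinations of images. *)
Definition fg_family (S : forall n, V n -> Prop) : Prop :=
  exists2 L : seq {n & V n},
    forall w, List.In w L -> S (tag w) (tagged w) &
    forall S', stable_family S' ->
      (forall w, List.In w L -> S' (tag w) (tagged w)) ->
      forall n x, S n x -> S' n x.

Hypothesis rank_ev : forall n (s t : T n), rank s = rank t -> ev s = ev t.
Hypothesis ev_span : forall n (x : V n), span (fun y => exists t, y = ev t) x.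
Hypothesis below_wqo : wqo below.
Hypothesis below_trans : forall s t u, below s t -> below t u -> below s u.
Hypothesis below_map : forall m n (s : T m) (t : T n),
  below (existT _ m s) (existT _ n t) ->
  exists phi : {linear V m -> V n}, [/\ adm phi, phi (ev s) = ev t &
    forall s', (rank s' < rank s)%N ->
      exists2 t', (rank t' < rank t)%N & phi (ev s') = ev t'].

Variables (W : forall n, V n -> Prop) (stabW : stable_family W).

Let lower n k := span (fun y : V n => exists2 t, (rank t < k)%N & y = ev t).

Lemma lower_submod n k : is_submod (@lower n k).
Proof. exact: span_submod. Qed.

Lemma lower_mono n k l x : (k <= l)%N -> @lower n k x -> @lower n l x.
Proof.
move=> kl; apply: span_mono => _ [t tk ->]; exists t => //.
exact: leq_trans kl.
Qed.

Lemma lower_ex n (x : V n) : exists k, lower k x.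
Proof.
elim: (ev_span x) => [|a _ y [t ->] _ [k yk]]; first by exists 0%N; apply: span0.
exists (maxn (rank t).+1 k); apply: span_cons.
  by exists t => //; apply: leq_maxl.
exact: lower_mono (leq_maxr _ _) yk.
Qed.

Lemma lowerS n k (x : V n) : lower k.+1 x ->
  lower k x \/ exists a t, rank t = k /\ lower k (x - a *: ev t).
Proof.
elim=> [|a _ y [t tk ->] _ IHy]; first by left; apply: span0.
move: tk; rewrite ltnS leq_eqVlt => /orP[/eqP tk|tk]; last first.
  case: IHy => [yk|[b [u [uk yk]]]].
    by left; apply: span_cons => //; exists t.
  right; exists b, u; split=> //; rewrite -addrA; apply: span_cons => //.
  by exists t.
right; case: IHy => [yk|[b [u [uk yk]]]].
  by exists a, t; split=> //; rewrite addrAC subrr add0r.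
exists (a + b), t; split=> //.
by rewrite (rank_ev (etrans tk (esym uk))) scalerDl opprD addrACA subrr add0r.
Qed.

(** Monomials may be linearly dependent, so that leading terms are not unique;
    moreover [r = 0] is allowed, which makes the leading coefficients at [t]
    an ideal. *)
Definition leads n (t : T n) (r : R) (w : V n) := lower (rank t) (w - r *: ev t).
Let lead (s : {n & T n} * R^o) :=
  exists2 w, W w & leads (tagged s.1) s.2 w.

Let lead_ideal (L : seq ({n & T n} * R^o)) (t : {n & T n}) :=
  span (fun r : R^o => exists2 s, List.In s L & below s.1 t /\ r = s.2).

(** Otherwise one chooses recursively leading terms [s n], each with a coefficient
    outside of the ideal generated by the coefficients of the earlier terms
    dividing it.  A subsequence increases for divisibility, and along it the
    coefficients contradict [noetherian_sequence]. *)
Lemma lead_ideals_fg : exists2 L,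
  forall s, List.In s L -> lead s & forall s, lead s -> lead_ideal L s.1 s.2.
Proof.
apply: contrapT => noL.
have step L : exists s, (forall s, List.In s L -> lead s) ->
    lead s /\ ~ lead_ideal L s.1 s.2.
  have [[s [ls sL]]|nos] := pselect (exists s, lead s /\ ~ lead_ideal L s.1 s.2).
    by exists s.
  have [Llead|nLlead] := pselect (forall s, List.In s L -> lead s).
    case: noL; exists L => // s ls; apply: contrapT => sL.
    by apply: nos; exists s.
  have [s _] : exists s, ~ (List.In s L -> lead s) by apply/existsNP.
  by exists s.
have [nx nxP] := choice step.
pose L n := iter n (fun l => nx l :: l) [::].
pose s n := nx (L n).
have Llead n : forall u, List.In u (L n) -> lead u.
  elim: n => //= n IHn u [<-|]; last exact: IHn.
  exact: (nxP _ IHn).1.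
have sL n : ~ lead_ideal (L n) (s n).1 (s n).2 := (nxP _ (Llead n)).2.
have sIn i j : (i < j)%N -> List.In (s i) (L j).
  elim: j => // j IHj; rewrite ltnS leq_eqVlt => /orP[/eqP->|/IHj]; first by left.
  by right.
have [g gI gP] := wqo_increasing below_wqo below_trans (fun n => (s n).1).
have [n an] := noetherian_sequence noethR (fun n => (s (g n)).2).
apply: (sL (g n)); apply: span_mono an => _ [i i_n ->].
by exists (s (g i)); [apply/sIn/gI | split=> //; apply: gP].
Qed.

(** Division with remainder: subtracting images of the finitely many vectors
    found by [lead_ideals_fg] from an element of [W] lowers its leading
    term. *)
Theorem groebner_fg : fg_family W.
Proof.
have [L Llead Lgen] := lead_ideals_fg.
have [L' L'W L'L] : exists2 L' : seq {n & V n},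
    forall w, List.In w L' -> W (tagged w) &
    forall s, List.In s L ->
      exists2 w : V (tag s.1), List.In (existT (fun n : D => V n : Type) _ w) L' &
        leads (tagged s.1) s.2 w.
  elim: (L) Llead => [|s l IHl] Llead; first by exists [::].
  have [|L' L'W L'l] := IHl; first by move=> u ul; apply: Llead; right.
  have [w Ww ws] := Llead s (or_introl erefl).
  exists (existT (fun n : D => V n : Type) _ w :: L').
    by move=> v [<-//|]; apply: L'W.
  move=> u [<-|/L'l[w' w'L' w'u]]; first by exists w => //; left.
  by exists w' => //; right.
exists L' => // S [Ssub Sadm] LS; have [Wsub Wadm] := stabW.
suff main n k (x : V n) : lower k x -> W x -> S n x.
  by move=> n x; have [k xk] := lower_ex x; apply: main xk.
elim: k x => [|k IHk] x xk Wx.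
  elim: xk => [|a _ y [t //]]; exact: (Ssub n).1.
have [|[a [t [tk yk]]]] := lowerS xk; first by move/IHk; apply.
suff [y [Wy Sy ya]] : exists y, [/\ W y, S n y & leads t a y].
  rewrite -[x](subrK y); apply: submodD (Ssub n) _ Sy; apply: IHk.
    rewrite -[x](subrK (a *: ev t)) -addrA; apply: submodD (lower_submod _ _) yk _.
    rewrite -opprB; apply: submodN (lower_submod _ _) _.
    by rewrite -tk.
  by apply: submodD (Wsub n) Wx _; apply: submodN (Wsub n) Wy.
have : lead_ideal L (existT _ n t) a.
  by apply: (Lgen (existT _ n t, a)); exists x => //; rewrite /leads tk.
elim=> [|b _ c [[[m s] r] sL [/below_map[phi [aphi phis phil]] ->]] _ [y [Wy Sy yc]]].
  exists 0; split; [exact: (Wsub n).1 | exact: (Ssub n).1 |].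
  by rewrite /leads scale0r subr0; apply: span0.
have /= [w wL' ws] := L'L _ sL.
exists (b *: phi w + y); split.
- by apply: (Wsub n).2 Wy; apply: Wadm aphi _ (L'W _ wL').
- by apply: (Ssub n).2 Sy; apply: Sadm aphi _ (LS _ wL').
rewrite /leads scalerDl opprD addrACA; apply: submodD (lower_submod _ _) _ yc.
rewrite -scalerA -scalerBr; apply: submodZ (lower_submod _ _) _.
rewrite -phis -linearZ -linearB; apply: span_linear ws => _ [s' s's ->].
by have [t' t't ->] := phil _ s's; exists t'.
Qed.

End Groebner.

(** The case of a single module, with the generators as monomials, the identity
    as only admissible map and equality as divisibility. *)
Lemma submodule_generators (R : comPzRingType) (noethR : noetherian R) (M : lmodType R)
    (S : M -> Prop) : fg_submod (fun _ : M => True) -> is_submod S ->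
  exists2 L : seq M, forall w, List.In w L -> S w &
    forall S', is_submod S' -> (forall w, List.In w L -> S' w) ->
      forall x, S x -> S' x.
Proof.
move=> [k [v [_ vgen]]] subS.
pose adm (_ _ : unit) (phi : M -> M) := forall x, phi x = x.
have [] := @groebner_fg R noethR unit (fun=> M) adm (fun=> 'I_k) (fun=> v) (fun=> val)
  (fun s t => tagged s = tagged t) _ _ _ _ _ (fun=> S) _.
- by move=> _ s t /val_inj->.
- move=> _ x; have [c ->] := vgen x I.
  apply: (big_ind (span _)) => [|y z|i _]; first exact: span0.
    exact: submodD (span_submod _).
  by apply: submodZ (span_submod _) _; apply: span_gen; exists i.
- move=> f; have [j infj] := infinite_pigeonhole (fun n => tagged (f n)).
  have [i _ fi] := infj 0%N; have [i' ii' fi'] := infj i.+1.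
  by exists i, i'; rewrite fi fi'.
- by move=> s t u -> ->.
- by move=> [] [] s t /= ->; exists idfun; split=> // s' s's; exists s'.
- by split=> // i j phi phiid x Sx; rewrite phiid.
move=> L LS Lgen; exists (map (fun w : {_ : unit & M} => tagged w) L).
  by move=> w /List.in_map_iff[[[] u] [<- /LS]].
move=> S' subS' LS' x; apply: (Lgen (fun=> S') _ _ tt) => //.
  by split=> // i j phi phiid y Sy; rewrite phiid.
by move=> [[] w] wL; apply: LS'; apply/List.in_map_iff; exists (existT _ tt w).
Qed.

(** * Split injections as pairs of integer matrices *)

Lemma vic_hom_eq (M N : vic_obj) (f g : vic_hom M N) :
  vic_inj f = vic_inj g -> vic_ret f = vic_ret g -> f = g.
Proof.
case: f g => [f f' fK] [g g' gK] /= eqfg eqfg'; case: _ / eqfg in gK *.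
by case: _ / eqfg' in gK *; congr VicHom; apply: Prop_irrelevance.
Qed.

Lemma vic_mx_subproof n m (F : 'M[int]_(m, n)) (G : 'M_(n, m)) :
  G *m F = 1%:M ->
  (linfun (mulmx G) \o linfun (mulmx F) = \1 :> 'End('cV[int]_n))%VF.
Proof.
move=> GF; apply/lfunP => x; rewrite comp_lfunE id_lfunE !lfunE /=.
by rewrite mulmxA GF mul1mx.
Qed.

Definition vic_mx n m (hn : (3 <= n)%N) (hm : (3 <= m)%N)
    (F : 'M[int]_(m, n)) (G : 'M_(n, m)) (GF : G *m F = 1%:M) :
  vic_hom (vic_Zn hn) (vic_Zn hm) :=
  @VicHom (vic_Zn hn) (vic_Zn hm) _ _ (vic_mx_subproof GF).

Lemma cV_lfun_mx n m (f : 'Hom('cV[int]_n, 'cV[int]_m)) :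
  exists F : 'M_(m, n), f = linfun (mulmx F).
Proof.
exists (\matrix_(i, j) f (delta_mx j 0) i 0); apply/lfunP => x.
rewrite lfunE /= [x in LHS]matrix_sum_delta linear_sum; apply/colP => i.
rewrite summxE mxE; apply: eq_bigr => j _; rewrite big_ord1 linearZ !mxE.
by rewrite mulrC.
Qed.

Lemma linfun_mulmx_inj n m (F G : 'M[int]_(m, n)) :
  linfun (mulmx F) = linfun (mulmx G) :> 'Hom('cV[int]_n, 'cV[int]_m) -> F = G.
Proof.
move=> eqFG; apply/matrixP => i j.
have /lfunP/(_ (delta_mx j 0)) := eqFG; rewrite !lfunE /= -!colE.
by move/colP/(_ i); rewrite !mxE.
Qed.

Lemma vic_mxP n m (hn : (3 <= n)%N) (hm : (3 <= m)%N)
    (f : vic_hom (vic_Zn hn) (vic_Zn hm)) :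
  exists F G (GF : G *m F = 1%:M), f = vic_mx hn hm GF.
Proof.
have [F fF] := cV_lfun_mx (vic_inj f : 'Hom('cV[int]_n, 'cV[int]_m)).
have [G fG] := cV_lfun_mx (vic_ret f : 'Hom('cV[int]_m, 'cV[int]_n)).
have GF : G *m F = 1%:M.
  apply: linfun_mulmx_inj; apply/lfunP => x.
  have /lfunP/(_ x) := vic_retK f; rewrite fF fG comp_lfunE id_lfunE !lfunE /=.
  by rewrite mulmxA mul1mx.
by exists F, G, GF; apply: vic_hom_eq.
Qed.

Section MatrixAction.
Variables (R : pzRingType) (V : vic_module R).

(** The action of the split injection [(F, G)], extended by [0] to all pairs of
    matrices, so that [F] and [G] can be rewritten without transporting a
    proof of [G *m F = 1%:M]. *)
Definition act n m (hn : (3 <= n)%N) (hm : (3 <= m)%N)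
    (F : 'M[int]_(m, n)) (G : 'M_(n, m)) (x : V (vic_Zn hn)) : V (vic_Zn hm) :=
  if pselect (G *m F = 1%:M) is left GF then vic_map V (vic_mx hn hm GF) x
  else 0.

Lemma actE n m (hn : (3 <= n)%N) (hm : (3 <= m)%N) F G
    (GF : G *m F = 1%:M) :
  act hm F G =1 vic_map V (vic_mx hn hm GF).
Proof.
move=> x; rewrite /act; case: pselect => // GF'.
by rewrite (Prop_irrelevance GF' GF).
Qed.

Lemma actM n m p (hn : (3 <= n)%N) (hm : (3 <= m)%N) (hp : (3 <= p)%N)
    (F1 : 'M_(m, n)) G1 (F2 : 'M_(p, m)) G2 (x : V (vic_Zn hn)) :
  G1 *m F1 = 1%:M -> G2 *m F2 = 1%:M ->
  act hp F2 G2 (act hm F1 G1 x) = act hp (F2 *m F1) (G1 *m G2) x.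
Proof.
move=> e1 e2.
have e21 : G1 *m G2 *m (F2 *m F1) = 1%:M.
  by rewrite mulmxA -(mulmxA G1) e2 mulmx1.
rewrite (actE _ e1) (actE _ e2) (actE _ e21) -vic_map_comp.
congr (vic_map V _ x); apply: vic_hom_eq; apply/lfunP => y;
  by rewrite comp_lfunE !lfunE /= mulmxA.
Qed.

Lemma act_GL n (hn : (3 <= n)%N) (A : 'M[int]_n) (uA : A \in unitmx)
    (x : V (vic_Zn hn)) :
  act hn A (invmx A) x = vic_map V (vic_GL hn uA) x.
Proof.
rewrite (actE _ (mulVmx uA)); congr (vic_map V _ x); exact: vic_hom_eq.
Qed.

End MatrixAction.
Arguments act {R V n m hn} hm F G x.

Section VicGeneration.
Variables (R : pzRingType) (V : vic_module R).
Implicit Types (L : seq {M : vic_obj & V M}) (M : vic_obj).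

Definition generated L M : V M -> Prop :=
  span (fun y => exists2 g, List.In g L &
    exists f : vic_hom (tag g) M, y = vic_map V f (tagged g)).

Lemma generated_submod L M : is_submod (@generated L M).
Proof. exact: span_submod. Qed.

Lemma generated_map L M N (f : vic_hom M N) x :
  generated L x -> generated L (vic_map V f x).
Proof.
apply: span_linear => _ [g gL [h ->]]; exists g => //.
by exists (vic_comp f h); rewrite vic_map_comp.
Qed.

Lemma generated_gen L g : List.In g L -> generated L (tagged g).
Proof.
move=> gL; apply: span_gen; exists g => //; exists (vic_id _).
by rewrite vic_map_id.
Qed.

Lemma generated_incl L L' M (x : V M) :
  List.incl L L' -> generated L x -> generated L' x.
Proof.
by move=> LL'; apply: span_mono => y [g /LL' gL' fP]; exists g.
Qed.

Lemma generated_fg (W : vic_submodule V) L :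
  (forall g, List.In g L -> W (tag g) (tagged g)) ->
  (forall M x, W M x -> generated L x) -> fg_vic_submodule W.
Proof.
move=> LW Wgen.
(* The default value of [nth], never reached. *)
pose g0 : {M : vic_obj & V M} := existT (fun M => V M : Type) (vic_Zn (leqnn 3)) 0.
pose X (i : 'I_(size L)) := tag (nth g0 L i).
pose v i : V (X i) := tagged (nth g0 L i).
have nthL g : List.In g L -> exists i : 'I_(size L), nth g0 L i = g.
  move=> gL; suff [i iL Di] : exists2 i, (i < size L)%N & nth g0 L i = g.
    by exists (Ordinal iL).
  elim: (L) gL => //= h l IHl [->|/IHl[i il Di]]; first by exists 0%N.
  by exists i.+1.
have inL (i : 'I_(size L)) : List.In (nth g0 L i) L.
  elim: (L) (nat_of_ord i) (ltn_ord i) => // h l IHl [|n] nl /=; first by left.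
  by right; apply: IHl.
exists (size L), X, v; split=> [j|M x /Wgen]; first exact: LW.
move=> xP; suff [n [t ->]] : exists n (t : 'I_n -> R * {j : 'I_(size L) & vic_hom (X j) M}),
    x = \sum_(i < n) (t i).1 *: vic_map V (tagged (t i).2) (v (tag (t i).2)).
  by exists n, (fun i => (t i).1), (fun i => tag (t i).2), (fun i => tagged (t i).2).
elim: xP => [|a _ y [g gL [f ->]] _ [n [t ->]]].
  by exists 0%N, (fun i : 'I_0 => False_rect _ (notF (ltn_ord i))); rewrite big_ord0.
have [i Di] := nthL _ gL; case: _ / Di in f gL *.
exists n.+1, (fun j => if unlift ord0 j is Some j' then t j'
                       else (a, existT (fun j => vic_hom (X j) M) i f)).
by rewrite big_ord_recl unlift_none /=; under [in RHS]eq_bigr do rewrite liftK.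
Qed.

End VicGeneration.

Section Coordinates.
Variable M : vic_obj.

Let coord : 'Hom(M, 'cV[int]_(dim M)) := linfun (trmx \o v2r).
Let uncoord : 'Hom('cV[int]_(dim M), M) := linfun (r2v \o trmx).

Lemma coordK : (uncoord \o coord = \1)%VF.
Proof. by apply/lfunP => x; rewrite comp_lfunE id_lfunE !lfunE /= trmxK v2rK. Qed.

Lemma uncoordK : (coord \o uncoord = \1)%VF.
Proof. by apply/lfunP => x; rewrite comp_lfunE id_lfunE !lfunE /= r2vK trmxK. Qed.

Definition to_Zn : vic_hom M (vic_Zn (vic_rank M)) :=
  @VicHom M (vic_Zn (vic_rank M)) _ _ coordK.
Definition of_Zn : vic_hom (vic_Zn (vic_rank M)) M :=
  @VicHom (vic_Zn (vic_rank M)) M _ _ uncoordK.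

Lemma to_ZnK (R : pzRingType) (V : vic_module R) (x : V M) :
  vic_map V of_Zn (vic_map V to_Zn x) = x.
Proof.
rewrite -vic_map_comp -[RHS]vic_map_id; congr (vic_map V _ x).
by apply: vic_hom_eq; exact: coordK.
Qed.

End Coordinates.

(** * Congruent split injections act alike *)

(** In the Smith normal form [F = Q D S] the diagonal block of [D] is invertible,
    because [F] has a retraction.  This gives [F] as the first columns of an
    invertible [P]; a unipotent change of the other columns adapts [P] to [G]. *)
Lemma split_mono_complement d m (F : 'M[int]_(d + m, d)) (G : 'M_(d, d + m)) :
  G *m F = 1%:M ->
  exists2 P : 'M_(d + m), P \in unitmx &
    F = P *m col_mx 1%:M 0 /\ G = row_mx 1%:M 0 *m invmx P.
Proof.
move=> GF; have [Q uQ [S uS [s _ FQS]]] := int_Smith_normal_form F.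
pose T := (\matrix_(i < d, j < d) (s`_i *+ (i == j :> nat))) *m S.
have FT : F = Q *m col_mx T 0.
  rewrite FQS -mulmxA; congr (_ *m _); rewrite -[LHS]vsubmxK -!mul_usub_mx -mul_dsub_mx.
  congr col_mx; first by congr (_ *m _); apply/matrixP => i j; rewrite !mxE.
  apply/matrixP => i j; rewrite !mxE big1 // => k _; rewrite !mxE.
  by rewrite gtn_eqF ?mul0r //= (leq_trans (ltn_ord k)) ?leq_addr.
pose P := Q *m block_mx T 0 0 1%:M.
have FP : F = P *m col_mx 1%:M 0.
  by rewrite FT -mulmxA mul_block_col !mulmx0 !mul0mx !addr0 mulmx1.
have uP : P \in unitmx.
  rewrite unitmx_mul uQ unitmxE det_ublock det1 mulr1 -unitmxE.
  have : (G *m Q *m col_mx 1%:M 0) *m T = 1%:M.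
    by rewrite -[RHS]GF FT -!mulmxA mul_col_mx mul1mx mul0mx.
  by case/mulmx1_unit.
have [X GP] : exists X, G *m P = row_mx 1%:M X.
  exists (rsubmx (G *m P)); rewrite -[LHS]hsubmxK; congr row_mx.
  move: GF; rewrite FP mulmxA -[G *m P]hsubmxK mul_row_col mulmx1 mulmx0 addr0.
  by rewrite row_mxKl.
pose U := block_mx 1%:M (- X) 0 1%:M : 'M[int]_(d + m).
have uU : U \in unitmx by rewrite unitmxE det_ublock !det1 mulr1 unitr1.
have uPU : P *m U \in unitmx by rewrite unitmx_mul uP.
exists (P *m U) => //; split.
  by rewrite -mulmxA mul_block_col !mulmx0 !mul0mx !addr0 mulmx1.
rewrite -[LHS](mulmxK uPU); congr (_ *m _).
rewrite mulmxA GP mul_row_block mulmx0 addr0 mulmx1 mul1mx mulmx1.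
by rewrite addNr.
Qed.

Lemma split_mono_pid n d (F : 'M[int]_(n, d)) (G : 'M_(d, n)) :
  (d <= n)%N -> G *m F = 1%:M ->
  exists2 P : 'M_n, P \in unitmx &
    F = P *m pid_mx d /\ G = pid_mx d *m invmx P.
Proof.
move/subnKC => dn; move: (n - d)%N dn F G => m <- F G /split_mono_complement.
by rewrite -pid_mx_col -pid_mx_row.
Qed.

Section Congruence.
Variables (R : pzRingType) (V : vic_module R).

(** If [L] is the order of the finite group through which [GL_n(Z)] acts, the
    matrix of [L] times [X] acts as an [L]-th power. *)
Lemma torsion_act n (hn : (3 <= n)%N) : pointwise_finite_type V ->
  exists2 L, (0 < L)%N & forall p q (U : 'M[int]_(p, q) -> 'M[int]_n),
    U 0 = 1%:M -> {morph U : X Y / X + Y >-> X *m Y} ->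
    forall X (x : V (vic_Zn hn)),
      act hn (U (L%:R *: X)) (U (- (L%:R *: X))) x = x.
Proof.
move=> /(_ n hn)[G [phi [psi [phiM psi1 psiM psiE]]]].
exists #|G|; first by apply/card_gt0P; exists 1%g.
move=> p q U U0 UD X x.
have UV Y : U (- Y) *m U Y = 1%:M by rewrite -UD addNr.
have uU Y : U Y \in unitmx by case/mulmx1_unit: (UV Y).
have phi1 : phi 1%:M = 1%g.
  have := phiM _ _ (unitmx1 _ _) (unitmx1 _ _); rewrite mul1mx.
  by move/(congr1 (mulg (phi 1%:M)^-1)); rewrite mulVg mulKg.
have phiX k : phi (U (k%:R *: X)) = (phi (U X) ^+ k)%g.
  elim: k => [|k IHk]; first by rewrite scale0r U0.
  by rewrite -natr1 scalerDl scale1r UD phiM // IHk expgSr.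
have -> : U (- (#|G|%:R *: X)) = invmx (U (#|G|%:R *: X)).
  by rewrite -[LHS](mulmxK (uU (#|G|%:R *: X))) UV mul1mx.
rewrite (act_GL (uU _)) psiE phiX.
suff -> : (phi (U X) ^+ #|G|)%g = 1%g by apply: psi1.
by apply/eqP; rewrite -order_dvdn -cardsT order_dvdG ?inE.
Qed.

Variables (d : nat) (hd : (3 <= d)%N).

(** The split injections on the left-hand sides are the translates of the
    standard inclusion by the upper and lower block unipotent matrices whose
    off-diagonal block is divisible by [l]. *)
Definition fixed_by_unipotents (l : int) : Prop :=
  forall m (h : (3 <= d + m)%N) (x : V (vic_Zn hd)),
    (forall X : 'M_(d, m), act h (col_mx 1%:M 0) (row_mx 1%:M (l *: X)) x =
                           act h (col_mx 1%:M 0) (row_mx 1%:M 0) x) /\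
    (forall X : 'M_(m, d), act h (col_mx 1%:M (l *: X)) (row_mx 1%:M 0) x =
                           act h (col_mx 1%:M 0) (row_mx 1%:M 0) x).

(** The level is found for [m = 1].  For general [m] the matrices [X] that fix
    the image of [V (vic_Zn hd)] are closed under addition, and a matrix with a
    single nonzero column (or row) [j] comes from [m = 1] through the map
    [sg j] sending the last basis vector to the [j]-th additional one. *)
Lemma finite_type_fixed_by_unipotents : pointwise_finite_type V ->
  exists2 L, (0 < L)%N & fixed_by_unipotents L%:R.
Proof.
have h1 : (3 <= d + 1)%N by rewrite (leq_trans hd) ?leq_addr.
case/(torsion_act h1) => L L_gt0 LP; exists L => // m h x.
pose up n (X : 'M[int]_(d, n)) := block_mx 1%:M X 0 1%:M.
pose lo n (X : 'M[int]_(n, d)) := block_mx 1%:M 0 X 1%:M.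
have upD n : {morph @up n : X Y / X + Y >-> X *m Y}.
  move=> X Y; rewrite mulmx_block !(mulmx1, mul1mx, mulmx0, mul0mx, addr0, add0r).
  by rewrite addrC.
have loD n : {morph @lo n : X Y / X + Y >-> X *m Y}.
  by move=> X Y; rewrite mulmx_block !(mulmx1, mul1mx, mulmx0, mul0mx, addr0, add0r).
have up0 n : up n 0 = 1%:M by rewrite /up -scalar_mx_block.
have lo0 n : lo n 0 = 1%:M by rewrite /lo -scalar_mx_block.
have upN n X : up n X *m up n (- X) = 1%:M by rewrite -upD subrr.
have upN' n X : up n (- X) *m up n X = 1%:M by rewrite -upD addNr.
have loN n X : lo n (- X) *m lo n X = 1%:M by rewrite -loD addNr.
pose sg (j : 'I_m) : 'M[int]_(d + m, d + 1) := block_mx 1%:M 0 0 (delta_mx j 0).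
pose sr (j : 'I_m) : 'M[int]_(d + 1, d + m) := block_mx 1%:M 0 0 (delta_mx 0 j).
have srg j : sr j *m sg j = 1%:M.
  rewrite mulmx_block !(mulmx1, mul1mx, mulmx0, mul0mx, addr0, add0r).
  rewrite mul_delta_mx scalar_mx_block; congr block_mx.
  by apply/matrixP => a b; rewrite !ord1 !mxE.
have upF n X : up n X *m col_mx 1%:M 0 = col_mx 1%:M 0.
  by rewrite mul_block_col !(mulmx1, mul1mx, mulmx0, mul0mx, addr0, add0r).
have loG n X : row_mx 1%:M 0 *m lo n X = row_mx 1%:M 0.
  by rewrite mul_row_block !(mulmx1, mul1mx, mulmx0, mul0mx, addr0, add0r).
have upG n X Y : row_mx 1%:M X *m up n Y = row_mx 1%:M (X + Y).
  by rewrite mul_row_block !(mulmx1, mul1mx, mulmx0, mul0mx, addr0, add0r) addrC.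
have loF n X Y : lo n Y *m col_mx 1%:M X = col_mx 1%:M (X + Y).
  by rewrite mul_block_col !(mulmx1, mul1mx, mulmx0, mul0mx, addr0, add0r) addrC.
have upI n X : row_mx 1%:M X *m col_mx 1%:M (0 : 'M[int]_(n, d)) = 1%:M.
  by rewrite mul_row_col mulmx1 mulmx0 addr0.
have loI n X : row_mx 1%:M (0 : 'M[int]_(d, n)) *m col_mx 1%:M X = 1%:M.
  by rewrite mul_row_col mulmx1 mul0mx addr0.
have sgF j X : sg j *m col_mx 1%:M X = col_mx 1%:M (delta_mx j 0 *m X).
  by rewrite mul_block_col !(mulmx1, mul1mx, mulmx0, mul0mx, addr0, add0r).
have srG j X : row_mx 1%:M X *m sr j = row_mx 1%:M (X *m delta_mx 0 j).
  by rewrite mul_row_block !(mulmx1, mul1mx, mulmx0, mul0mx, addr0, add0r).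
split=> X.
  pose fixed (Y : 'M_(d, m)) := act h (col_mx 1%:M 0) (row_mx 1%:M Y) x =
                         act h (col_mx 1%:M 0) (row_mx 1%:M 0) x.
  have fixedD Y Z : fixed Y -> fixed Z -> fixed (Y + Z).
    move=> fY fZ; rewrite /fixed -fZ; have /= := congr1 (act h (up m (- Z)) (up m Z)) fY.
    by rewrite !actM ?upN ?upF ?upG ?add0r ?upI.
  suff fixed1 j (Y : 'cV_d) : fixed (L%:R *: Y *m delta_mx 0 j).
    have -> : L%:R *: X = \sum_j L%:R *: col j X *m delta_mx 0 j.
      apply/matrixP => a b; rewrite summxE (bigD1 b) //= big1 => [|j jb].
        by rewrite addr0 [RHS]mxE big_ord1 !mxE !eqxx mulr1.
      by rewrite mxE big_ord1 !mxE [b == j]eq_sym (negPf jb) andbF mulr0.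
    by apply: (big_ind fixed).
  have /(congr1 (act h (sg j) (sr j))) :=
    LP _ _ (up 1) (up0 1) (@upD 1) (- Y) (act h1 (col_mx 1%:M 0) (row_mx 1%:M 0) x).
  rewrite !actM ?upN' ?upI ?srg //.
  - by rewrite -!mulmxA upF sgF mulmx0 mulmxA upG !srG add0r mul0mx scalerN opprK.
  - by rewrite -mulmxA (mulmxA (sr j)) srg mul1mx upN'.
pose fixed (Y : 'M_(m, d)) := act h (col_mx 1%:M Y) (row_mx 1%:M 0) x =
                       act h (col_mx 1%:M 0) (row_mx 1%:M 0) x.
have fixedD Y Z : fixed Y -> fixed Z -> fixed (Y + Z).
  move=> fY fZ; rewrite /fixed -fZ; have /= := congr1 (act h (lo m Z) (lo m (- Z))) fY.
  by rewrite !actM ?loN ?loF ?loG ?add0r ?loI.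
suff fixed1 j (Y : 'rV_d) : fixed (delta_mx j 0 *m (L%:R *: Y)).
  have -> : L%:R *: X = \sum_j delta_mx j 0 *m (L%:R *: row j X).
    apply/matrixP => a b; rewrite summxE (bigD1 a) //= big1 => [|j ja].
      by rewrite addr0 [RHS]mxE big_ord1 !mxE !eqxx mul1r.
    by rewrite mxE big_ord1 !mxE [a == j]eq_sym (negPf ja) mul0r.
  by apply: (big_ind fixed).
have /(congr1 (act h (sg j) (sr j))) :=
  LP _ _ (lo 1) (lo0 1) (@loD 1) Y (act h1 (col_mx 1%:M 0) (row_mx 1%:M 0) x).
rewrite !actM ?srg ?loI ?loN //.
- by rewrite -!mulmxA loF !sgF mulmx0 mulmxA loG srG mul0mx add0r.
- by rewrite -mulmxA (mulmxA (sr j)) srg mul1mx loN.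
Qed.

Variable l : int.
Hypothesis unipotents_fixed : fixed_by_unipotents l.

Section Fixes.
Variables (m : nat) (h : (3 <= d + m)%N).

Definition acts_as_incl (F : 'M[int]_(d + m, d)) (G : 'M_(d, d + m)) : Prop :=
  G *m F = 1%:M -> forall x : V (vic_Zn hd),
    act h F G x = act h (col_mx 1%:M 0) (row_mx 1%:M 0) x.

Lemma incl_split : row_mx 1%:M 0 *m col_mx 1%:M (0 : 'M[int]_(m, d)) = 1%:M.
Proof. by rewrite mul_row_col mulmx1 mulmx0 addr0. Qed.

(** If [Q] fixes the image of the standard inclusion, [(F, G)] may be replaced by
    its translate under [Q]. *)
Lemma acts_as_incl_step (Q Q' : 'M_(d + m)) F G : Q' *m Q = 1%:M ->
    acts_as_incl (Q' *m col_mx 1%:M 0) (row_mx 1%:M 0 *m Q) ->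
  acts_as_incl (Q *m F) (G *m Q') -> acts_as_incl F G.
Proof.
move=> Q'Q Qi QFG GF x; have QQ' := mulmx1C Q'Q.
have QGF : G *m Q' *m (Q *m F) = 1%:M by rewrite -mulmxA (mulmxA Q') Q'Q mul1mx.
have /(congr1 (act h Q' Q)) := QFG QGF x.
rewrite !actM ?incl_split // mulmxA Q'Q mul1mx -mulmxA Q'Q mulmx1 => ->.
by apply: Qi; rewrite -mulmxA (mulmxA Q) QQ' mul1mx incl_split.
Qed.

Variables (F1 : 'M[int]_d) (F2 : 'M[int]_(m, d)) (G1 : 'M[int]_d) (G2 : 'M[int]_(d, m)).

Lemma acts_as_incl_diag (P P' : 'M_m) : P' *m P = 1%:M ->
  acts_as_incl (col_mx F1 (P *m F2)) (row_mx G1 (G2 *m P')) ->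
  acts_as_incl (col_mx F1 F2) (row_mx G1 G2).
Proof.
move=> P'P HP.
apply: (acts_as_incl_step (Q := block_mx 1%:M 0 0 P) (Q' := block_mx 1%:M 0 0 P')).
- by rewrite mulmx_block !(mulmx1, mulmx0, mul0mx, addr0, add0r) P'P -scalar_mx_block.
- by rewrite mul_block_col mul_row_block !(mulmx1, mulmx0, mul0mx, addr0).
- by rewrite mul_block_col mul_row_block !(mul1mx, mulmx1, mulmx0, mul0mx, addr0, add0r).
Qed.

Lemma acts_as_incl_lower (X : 'M_(m, d)) :
  acts_as_incl (col_mx F1 (F2 + l *: X *m F1)) (row_mx (G1 - G2 *m (l *: X)) G2) ->
  acts_as_incl (col_mx F1 F2) (row_mx G1 G2).
Proof.
move=> HX.
apply: (acts_as_incl_step (Q := block_mx 1%:M 0 (l *: X) 1%:M)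
                          (Q' := block_mx 1%:M 0 (- (l *: X)) 1%:M)).
- by rewrite mulmx_block !(mulmx1, mul1mx, mulmx0, mul0mx, addr0, add0r) addNr
             -scalar_mx_block.
- rewrite mul_block_col mul_row_block !(mulmx1, mul1mx, mulmx0, mul0mx, addr0).
  by rewrite -scalerN => _ x; apply: (unipotents_fixed h x).2.
- rewrite mul_block_col mul_row_block !(mul1mx, mulmx1, mulmx0, mul0mx, addr0, add0r).
  by rewrite addrC mulmxN.
Qed.

Lemma acts_as_incl_upper (X : 'M_(d, m)) :
  acts_as_incl (col_mx (F1 + l *: X *m F2) F2) (row_mx G1 (G2 - G1 *m (l *: X))) ->
  acts_as_incl (col_mx F1 F2) (row_mx G1 G2).
Proof.
move=> HX.
apply: (acts_as_incl_step (Q := block_mx 1%:M (l *: X) 0 1%:M)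
                          (Q' := block_mx 1%:M (- (l *: X)) 0 1%:M)).
- by rewrite mulmx_block !(mulmx1, mul1mx, mulmx0, mul0mx, addr0, add0r) subrr
             -scalar_mx_block.
- rewrite mul_block_col mul_row_block !(mulmx1, mul1mx, mulmx0, mul0mx, addr0, add0r).
  by move=> _ x; apply: (unipotents_fixed h x).1.
- rewrite mul_block_col mul_row_block !(mul1mx, mulmx1, mulmx0, mul0mx, addr0, add0r).
  by rewrite mulmxN [- _ + _]addrC.
Qed.

End Fixes.

(** Smith normal form for [b] makes the last [d] rows of [F] vanish, as there are
    at least [d] rows before them.  The combinations of the other rows with
    coefficients in [G] form the identity matrix, because [G *m F = 1%:M];
    adding [l] times these combinations replaces the zero block by [l].  With
    it, row operations of level [l] clear [l ^+ 2 *: a], which is why [F] has to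
    be standard modulo [l ^+ 2] and not only modulo [l].  Then [F] is the
    standard inclusion, and [(F, G)] its translate by a unipotent of
    level [l]. *)
Lemma congruent_incl_acts_as_incl m (dm : (d <= m)%N) (h : (3 <= d + (m + d))%N)
    (a : 'M[int]_d) (b : 'M[int]_(m + d, d)) (G1 : 'M[int]_d) (z : 'M[int]_(d, m + d)) :
  acts_as_incl h (col_mx (1%:M + l ^+ 2 *: a) (l ^+ 2 *: b)) (row_mx G1 (l *: z)).
Proof.
have [P uP [S _ [s _ Db]]] := int_Smith_normal_form b.
have {Db}[b1 Db] : exists b1, invmx P *m b = col_mx b1 0.
  exists (usubmx (invmx P *m b)); rewrite -[LHS]vsubmxK; congr col_mx.
  rewrite Db -mulmxA mulKmx // -mul_dsub_mx.
  apply/matrixP => i j; rewrite mxE [RHS]mxE big1 // => k _; rewrite !mxE.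
  rewrite gtn_eqF ?mul0r //=.
  exact: leq_trans (ltn_ord k) (leq_trans dm (leq_addr _ _)).
apply: (@acts_as_incl_diag _ _ _ _ _ _ (invmx P) P); first by rewrite mulmxV.
rewrite -scalemxAr Db -scalemxAl scale_col_mx scaler0 {b Db}.
move: (z *m P) => {}z; rewrite -[z]hsubmxK.
move: (lsubmx z) (rsubmx z) => z1 z2 {z}.
set F1 := 1%:M + _; move=> GF.
suff : acts_as_incl h (col_mx F1 (col_mx (l ^+ 2 *: b1) 0))
    (row_mx G1 (l *: row_mx z1 z2)) by apply.
have {GF} e : G1 *m F1 + l *: z1 *m (l ^+ 2 *: b1) = 1%:M.
  by rewrite -GF scale_row_mx !mul_row_col mulmx0 addr0.
(* The zero rows become [l *: G1 *m F1]; the rows of [b1] contribute the rest of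
   [l *: (G *m F)] by means of [Q], which only involves the last [m + d]
   coordinates. *)
apply: (acts_as_incl_lower (X := col_mx 0 G1)).
pose Q : 'M[int]_(m + d) := block_mx 1%:M 0 (l ^+ 2 *: z1) 1%:M.
pose Q' : 'M[int]_(m + d) := block_mx 1%:M 0 (- (l ^+ 2 *: z1)) 1%:M.
apply: (acts_as_incl_diag (P := Q) (P' := Q')).
  by rewrite mulmx_block !(mulmx1, mul1mx, mulmx0, mul0mx, addr0, add0r) addNr
             -scalar_mx_block.
have -> : Q *m (col_mx (l ^+ 2 *: b1) 0 + l *: col_mx 0 G1 *m F1) =
          col_mx (l ^+ 2 *: b1) l%:M.
  rewrite scale_col_mx scaler0 mul_col_mx mul0mx add_col_mx addr0 add0r.
  rewrite mul_block_col !mul1mx mul0mx addr0; congr col_mx.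
  rewrite -scalemx1 -e scalerDr -!scalemxAl addrC; congr (_ + _).
  by rewrite scalerA -expr2.
have -> : l *: row_mx z1 z2 *m Q' = l *: (row_mx z1 z2 *m Q').
  by rewrite scalemxAl.
move: (G1 - _) (_ *m Q') => {}G1 z {e Q Q' z1 z2}.
(* The block [l] clears [l ^+ 2 *: a]. *)
apply: (acts_as_incl_upper (X := row_mx 0 (- a))).
have -> : F1 + l *: row_mx 0 (- a) *m col_mx (l ^+ 2 *: b1) l%:M = 1%:M.
  rewrite scale_row_mx mul_row_col scaler0 mul0mx add0r mul_mx_scalar scalerA.
  by rewrite scalerN -expr2 /F1 addrK.
rewrite -scalemxAr -scalerBr; move: (z - _) => {}z.
apply: (acts_as_incl_lower (X := - col_mx (l *: b1) 1%:M)).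
have -> : col_mx (l ^+ 2 *: b1) l%:M + l *: (- col_mx (l *: b1) 1%:M) *m 1%:M = 0.
  by rewrite mulmx1 scalerN scale_col_mx scalerA -expr2 scalemx1 subrr.
move: (G1 - _) => {}G1 e x; have -> : G1 = 1%:M.
  by rewrite -e mul_row_col mulmx1 mulmx0 addr0.
exact: (unipotents_fixed h x).1.
Qed.

(** An invertible matrix moves [(F', G')] to the standard inclusion, which
    reduces this to [congruent_incl_acts_as_incl]. *)
Theorem congruent_act n (h : (3 <= n)%N) (F F' : 'M[int]_(n, d)) (G G' : 'M_(d, n)) :
    (3 * d <= n)%N -> G *m F = 1%:M -> G' *m F' = 1%:M ->
    (exists A, F = F' + l ^+ 2 *: A) -> (exists C, G = G' + l ^+ 2 *: C) ->
  forall x : V (vic_Zn hd), act h F G x = act h F' G' x.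
Proof.
move=> d3n GF GF' [A FA] [C GC] x.
have [m dm Dn] : exists2 m, (d <= m)%N & (n = d + (m + d))%N.
  by exists (n - (d + d))%N; lia.
case: _ / (esym Dn) in h F F' G G' A C FA GC GF GF' {d3n} *.
have [P uP [F'P G'P]] := split_mono_complement GF'.
have DF : invmx P *m F =
    col_mx (1%:M + l ^+ 2 *: usubmx (invmx P *m A)) (l ^+ 2 *: dsubmx (invmx P *m A)).
  rewrite FA F'P mulmxDr mulKmx // -scalemxAr -{1}[invmx P *m A]vsubmxK.
  by rewrite scale_col_mx add_col_mx add0r.
have DG : G *m P =
    row_mx (1%:M + l ^+ 2 *: lsubmx (C *m P)) (l *: (l *: rsubmx (C *m P))).
  rewrite GC G'P mulmxDl mulmxKV // -scalemxAl -{1}[C *m P]hsubmxK.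
  by rewrite scale_row_mx add_row_mx add0r scalerA -expr2.
have GPF : G *m P *m (invmx P *m F) = 1%:M by rewrite mulmxA mulmxK.
have := congruent_incl_acts_as_incl dm; rewrite /acts_as_incl => /(_ h _ _ _ _ _ x).
move=> fixF; have := fixF (usubmx (invmx P *m A)) (dsubmx (invmx P *m A)) _ (l *: rsubmx (C *m P)).
rewrite -DF => /(_ (1%:M + l ^+ 2 *: lsubmx (C *m P))); rewrite -DG => /(_ GPF).
move/(congr1 (act h P (invmx P))); rewrite !actM ?incl_split ?mulVmx //.
by rewrite mulKVmx // mulmxK // -F'P -G'P.
Qed.

End Congruence.

(** * Words of split injections *)

Section Residues.
Variable N : nat.

Definition residue (x : int) : 'I_N.+1 := inord `|(x %% N.+1%:Z)%Z|%N.

Lemma residueE x y : residue x = residue y <-> exists q, x = y + N.+1%:Z * q.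
Proof.
have residue_nat z : (residue z : nat)%:Z = (z %% N.+1%:Z)%Z.
  rewrite inordK; last by have := ltz_pmod z (isT : 0 < N.+1%:Z)%R; lia.
  by rewrite gez0_abs ?modz_ge0.
split=> [/(congr1 (fun i : 'I_N.+1 => (i : nat)%:Z))|[q ->]].
  rewrite !residue_nat => /eqP; rewrite eqz_mod_dvd => /dvdzP[q Dq].
  by exists q; rewrite mulrC -Dq addrC subrK.
by rewrite /residue addrC mulrC modzMDl.
Qed.

Variables (d : nat).
Definition letter : Type := {ffun 'I_d + 'I_d -> 'I_N.+1}.
HB.instance Definition _ := Finite.on letter.

Definition row_letter n (F : 'M[int]_(n, d)) (G : 'M_(d, n)) (s : 'I_n) : letter :=
  [ffun z => match z with inl j => residue (F s j) | inr j => residue (G j s) end].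

Definition word n (F : 'M[int]_(n, d)) (G : 'M_(d, n)) : seq letter :=
  [seq row_letter F G s | s <- enum 'I_n].

Lemma size_word n (F : 'M[int]_(n, d)) (G : 'M_(d, n)) : size (word F G) = n.
Proof. by rewrite size_map size_enum_ord. Qed.

Lemma nth_word n (F : 'M[int]_(n, d)) (G : 'M_(d, n)) b0 (s : 'I_n) :
  nth b0 (word F G) s = row_letter F G s.
Proof. by rewrite (nth_map s) ?size_enum_ord // nth_ord_enum. Qed.

Lemma word_eq_congruent n (F F' : 'M[int]_(n, d)) (G G' : 'M_(d, n)) :
  word F G = word F' G' ->
  (exists A, F = F' + N.+1%:Z *: A) /\ (exists C, G = G' + N.+1%:Z *: C).
Proof.
move=> eqw; have eql s : row_letter F G s = row_letter F' G' s.
  by move: (nth_word F G (row_letter F G s) s) => <-; rewrite eqw nth_word.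
have eqF s j : exists q, F s j = F' s j + N.+1%:Z * q.
  apply/residueE.
  by have := congr1 (fun f : letter => f (inl j)) (eql s); rewrite !ffunE.
have eqG j s : exists q, G j s = G' j s + N.+1%:Z * q.
  apply/residueE.
  by have := congr1 (fun f : letter => f (inr j)) (eql s); rewrite !ffunE.
split.
  have [A AP] := choice (fun sj : 'I_n * 'I_d => eqF sj.1 sj.2).
  by exists (\matrix_(s, j) A (s, j)); apply/matrixP => s j; rewrite !mxE (AP (s, j)).
have [A AP] := choice (fun sj : 'I_d * 'I_n => eqG sj.1 sj.2).
by exists (\matrix_(s, j) A (s, j)); apply/matrixP => s j; rewrite !mxE (AP (s, j)).
Qed.

Section Pullback.
Variables (n m : nat) (p : seq nat).
Hypotheses (size_p : size p = m) (rgs_p : rgs 0 n p).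
Hypothesis count_p : forall i, (i < n)%N -> count_mem i p = 1%N %[mod N.+1].

Definition copy_inj : 'M[int]_(m, n) := \matrix_(s, i) (nth 0%N p s == i)%:R.

(** The product of the transpose of [copy_inj] with [copy_inj] is diagonal, with
    the fibre sizes of [p] as entries.  Subtracting the excess over 1 at the
    first copy gives a retraction; modulo [N.+1] it is still the transpose. *)
Definition copy_ret : 'M[int]_(n, m) :=
  \matrix_(i, s) ((nth 0%N p s == i)%:R
                  - ((count_mem (i : nat) p)%:R - 1) *+ (s == index (i : nat) p :> nat)).

Lemma nth_p_lt (s : 'I_m) : (nth 0%N p s < n)%N.
Proof. by apply: rgs_bound rgs_p _; rewrite mem_nth ?size_p. Qed.

Lemma copy_injK : copy_ret *m copy_inj = 1%:M.
Proof.
apply/matrixP => i j; rewrite !mxE.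
have ip : (i : nat) \in p by apply: rgs_mem rgs_p _ _.
under eq_bigr => s _ do rewrite !mxE mulrBl.
rewrite big_split /= sumrN.
have s0_lt : (index (i : nat) p < m)%N by rewrite -size_p index_mem.
rewrite [X in _ - X](bigD1 (Ordinal s0_lt)) //= eqxx nth_index //.
rewrite [X in _ - (_ + X)]big1 ?addr0; last first.
  by move=> s; rewrite -val_eqE /= => /negPf->; rewrite mul0r.
have -> : \sum_(s < m) (nth 0%N p s == i)%:R * (nth 0%N p s == j)%:R =
          (i == j)%:R * (count_mem (i : nat) p)%:R :> int.
  rewrite -sum1_count (big_nth 0%N) size_p big_mkord natr_sum [in RHS]big_mkcond [RHS]big_distrr /=.
  apply: eq_bigr => s _ /=; case: eqP => [->|_]; rewrite ?mul0r ?mulr0 // mul1r mulr1.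
  by rewrite val_eqE.
rewrite val_eqE; case: eqP => _; rewrite ?mulr0 ?mul0r ?subr0 //.
by rewrite mul1r mulr1n mulr1 opprB addrC subrK.
Qed.

(** Copying letters: the rows of [F] are copied literally, the columns of [G] up to
    multiples of [N.+1]. *)
Lemma word_copy (F : 'M[int]_(n, d)) (G : 'M_(d, n)) b0 :
  word (copy_inj *m F) (G *m copy_ret) = [seq nth b0 (word F G) i | i <- p].
Proof.
apply: (@eq_from_nth _ b0); first by rewrite size_word size_map.
move=> s; rewrite size_word => s_m; rewrite (nth_map 0%N) ?size_p //.
have s_n := nth_p_lt (Ordinal s_m).
rewrite (nth_word _ _ _ (Ordinal s_m)) (nth_word _ _ _ (Ordinal s_n)).
apply/ffunP => -[] j; rewrite !ffunE.
  congr residue; rewrite mxE (bigD1 (Ordinal s_n)) //= mxE eqxx mul1r big1 ?addr0 //.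
  by move=> i; rewrite -val_eqE /= eq_sym mxE => /negPf->; rewrite mul0r.
apply/residueE.
have exq (i : 'I_n) : exists q, (count_mem (i : nat) p)%:R - 1 = N.+1%:Z * q.
  have /eqP := count_p (ltn_ord i).
  have cp : (0 < count_mem (i : nat) p)%N.
    by rewrite -has_count has_pred1; apply: rgs_mem rgs_p _ _.
  rewrite eqn_mod_dvd // => /dvdnP[c Dc]; exists c%:Z.
  by rewrite -(natrB _ cp) Dc natrM mulrC !natz.
have [q qP] := choice exq.
exists (- \sum_(i < n) G j i * (q i *+ (s == index (i : nat) p))).
rewrite mxE; under eq_bigr => i _ do rewrite mxE mulrBr qP.
rewrite big_split /= mulrN; congr (_ + _); last first.
  rewrite sumrN mulr_sumr; congr (- _); apply: eq_bigr => i _.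
  by rewrite mulrCA -mulrnAr.
rewrite (bigD1 (Ordinal s_n)) //= eqxx mulr1 big1 ?addr0 //.
by move=> i; rewrite -val_eqE /= eq_sym => /negPf->; rewrite mulr0.
Qed.

End Pullback.
End Residues.

(** * Noetherianity *)

(** In coordinates, each generator lives in some rank [dim (X j)].  By
    [split_mono_pid] any split injection from that rank to [n >= d] factors
    through the standard inclusion in rank [d], where [d] exceeds all these
    ranks. *)
Lemma fg_common_rank (R : pzRingType) (V : vic_module R) : fg_vic_module V ->
  exists (d : nat) (hd : (3 <= d)%N) (k : nat) (v : 'I_k -> V (vic_Zn hd)),
    forall n (hn : (3 <= n)%N), (d <= n)%N -> forall x : V (vic_Zn hn),
      span (fun y => exists j F G, G *m F = 1%:M /\ y = act hn F G (v j)) x.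
Proof.
move=> [k [X [v [_ vgen]]]].
pose d := (3 + \sum_j dim (X j))%N.
have Xd j : (dim (X j) <= d)%N.
  by rewrite /d (bigD1 j) //= addnCA leq_addr.
have hd : (3 <= d)%N by rewrite leq_addr.
exists d, hd, k.
exists (fun j => act hd (pid_mx (dim (X j))) (pid_mx (dim (X j))) (vic_map V (to_Zn (X j)) (v j))).
move=> n hn dn x; have [r [c [j [f ->]]]] := vgen _ x I.
apply: (big_ind (span _)) => [|y z|i _]; first exact: span0.
  exact: submodD (span_submod _).
apply: submodZ (span_submod _) _; apply: span_gen; exists (j i).
rewrite -[v (j i)]to_ZnK -vic_map_comp.
have [F [G [GF ->]]] := vic_mxP (vic_comp (f i) (of_Zn (X (j i)))).
have [P uP [FP GP]] := split_mono_pid (leq_trans (Xd (j i)) dn) GF.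
have pidK a b : (a <= b)%N ->
    (pid_mx a : 'M[int]_(a, b)) *m (pid_mx a : 'M_(b, a)) = 1%:M.
  by move=> ab; rewrite mul_pid_mx minnn (minn_idPr ab) pid_mx_1.
have Pi : (pid_mx d *m invmx P) *m (P *m pid_mx d : 'M_(n, d)) = 1%:M.
  by rewrite mulmxA mulmxKV // pidK.
exists (P *m pid_mx d), (pid_mx d *m invmx P); split=> //.
rewrite -(actE _ GF) actM ?pidK // FP GP; congr act.
  by rewrite -mulmxA mul_pid_mx (minn_idPr (Xd _)) (minn_idPr (Xd _)).
  by rewrite mulmxA mul_pid_mx (minn_idPl (Xd _)) (minn_idPr (Xd _)).
by rewrite to_ZnK.
Qed.

(** The monomials of rank [n] are the pairs of a generator [v j] and a split
    injection [Z^d -> Z^n], ordered by [j] first and then by the word of the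
    injection.  Distinct monomials may have the same rank, but then they have
    the same value. *)
Section HighRank.
Variables (R : comPzRingType) (noethR : noetherian R) (V : vic_module R).
Variables (d : nat) (hd : (3 <= d)%N) (k : nat) (v : 'I_k -> V (vic_Zn hd)) (N : nat).
Hypothesis incl_span : forall n (hn : (3 <= n)%N), (3 * d <= n)%N -> forall x : V (vic_Zn hn),
      span (fun y => exists j F G, G *m F = 1%:M /\ y = act hn F G (v j)) x.
Hypothesis congruentP : forall n (hn : (3 <= n)%N) (F F' : 'M[int]_(n, d)) (G G' : 'M_(d, n)),
    (3 * d <= n)%N -> G *m F = 1%:M -> G' *m F' = 1%:M ->
    (exists A, F = F' + N.+1%:Z *: A) -> (exists C, G = G' + N.+1%:Z *: C) ->
  forall x : V (vic_Zn hd), act hn F G x = act hn F' G' x.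
Variable W : vic_submodule V.

Let rk := {n : nat | (3 * d <= n)%N}.
Let rk_ge3 (n : rk) : (3 <= val n)%N.
Proof. by case: n => n /=; lia. Qed.
Let Zn (n : rk) : vic_obj := vic_Zn (rk_ge3 n).

Let mono (n : rk) : Type :=
  {t : 'I_k * ('M[int]_(val n, d) * 'M[int]_(d, val n)) | t.2.2 *m t.2.1 == 1%:M}.
Let gen_of n (t : mono n) : 'I_k := (val t).1.
Let mx_of n (t : mono n) := (val t).2.1.
Let ret_of n (t : mono n) := (val t).2.2.
Let mono_split n (t : mono n) : ret_of t *m mx_of t = 1%:M := eqP (valP t).
Let ev n (t : mono n) : V (Zn n) := act (rk_ge3 n) (mx_of t) (ret_of t) (v (gen_of t)).
Let word_of n (t : mono n) : seq (letter N d) := word N (mx_of t) (ret_of t).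
Let rank n (t : mono n) : nat :=
  (gen_of t * #|{: letter N d}| ^ val n + lexval (word_of t))%N.
(* Every letter also carries the generator and the colour of the word; as words
   are nonempty, subwords then have the same generator and colour. *)
Let code (s : {n & mono n}) :=
  [seq (gen_of (tagged s), colour N (word_of (tagged s)), b)
     | b <- marked set0 (word_of (tagged s))].
Let adm (m n : rk) (phi : V (Zn m) -> V (Zn n)) :=
  exists f : vic_hom (Zn m) (Zn n), phi =1 vic_map V f.

Lemma fg_high_rank : exists2 L : seq {M : vic_obj & V M},
  forall g, List.In g L -> W (tag g) (tagged g) &
  forall n (hn : (3 <= n)%N), (3 * d <= n)%N ->
    forall x : V (vic_Zn hn), W _ x -> generated L x.
Proof.
have lexval_w n (t : mono n) : (lexval (word_of t) < #|{: letter N d}| ^ val n)%N.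
  by have := lexval_lt (word_of t); rewrite size_word.
have [] := @groebner_fg R noethR rk (fun n => V (Zn n)) adm mono ev rank
  (fun s t => subseq (code s) (code t)) _ _ _ _ _ (fun n => W (Zn n)) _.
- move=> n s t /digit_inj[||/ord_inj eqj /lexval_inj eqw]; rewrite ?lexval_w //.
  have [|] := word_eq_congruent (eqw _); first by rewrite !size_word.
  move=> FA GC; rewrite /ev eqj; apply: congruentP => //; exact: valP n.
- move=> n x; apply: span_mono (incl_span (valP n) x) => _ [j [F [G [/eqP GF ->]]]].
  by exists (exist (fun t => t.2.2 *m t.2.1 == 1%:M) (j, (F, G)) GF).
- move=> f; exact: (higman (fun i => code (f i))).
- by move=> s t u; apply: subseq_trans.
- move=> m n s t; rewrite /code /= => sub.
  have w0 : word_of s != [::].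
    by rewrite -size_eq0 size_word; have := rk_ge3 m; case: (val m).
  have [[eqj eqc] sub'] : (gen_of s = gen_of t /\
      colour N (word_of s) = colour N (word_of t)) /\
      subseq (marked set0 (word_of s)) (marked set0 (word_of t)).
    split; last first.
      have := map_subseq (fun z => z.2) sub; rewrite -!map_comp.
      by rewrite !(eq_map (g := id)) // !map_id.
    case: (word_of s) w0 sub => // b w _ /mem_subseq/(_ _ (mem_head _ _)).
    case/mapP => b' _ eqst; split.
      exact: (congr1 (fun z => z.1.1) eqst).
    exact: (congr1 (fun z => z.1.2) eqst).
  have b0 : letter N d by case: (word_of s) w0.
  have [p [pP wtP pc]] := marked_pullback b0 sub' eqc.
  rewrite size_word in pP pc.
  have szp : size p = val n.
    by have := congr1 size wtP; rewrite size_word size_map => ->.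
  have GF := copy_injK szp pP.
  exists (vic_map V (vic_mx (rk_ge3 m) (rk_ge3 n) GF)).
  pose F' (u : mono m) := copy_inj (val m) (val n) p *m mx_of u.
  pose G' (u : mono m) := ret_of u *m copy_ret (val m) (val n) p.
  have GF' u : G' u *m F' u = 1%:M.
    by rewrite /G' /F' -mulmxA (mulmxA _ _ (mx_of u)) GF mul1mx mono_split.
  have evF' u : vic_map V (vic_mx (rk_ge3 m) (rk_ge3 n) GF) (ev u) =
      act (rk_ge3 n) (F' u) (G' u) (v (gen_of u)).
    by rewrite -(actE _ GF) /ev actM ?mono_split.
  have wordF' u : word N (F' u) (G' u) = [seq nth b0 (word_of u) i | i <- p].
    exact: word_copy.
  split; first by exists (vic_mx (rk_ge3 m) (rk_ge3 n) GF).
    rewrite evF' eqj; have [] := word_eq_congruent (etrans (wordF' s) (esym wtP)).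
    by move=> FA GC; apply: congruentP => //; exact: valP n.
  move=> u; rewrite /rank digit_lt ?lexval_w // => lt_us.
  exists (exist (fun t => t.2.2 *m t.2.1 == 1%:M) (gen_of u, (F' u, G' u))
                (introT eqP (GF' u))); last exact: evF'.
  rewrite digit_lt ?lexval_w // [word_of (exist _ _ _)]wordF' wtP -eqj.
  case/orP: lt_us => [-> //|/andP[/eqP eqju lt_us]]; apply/orP; right.
  apply/andP; split; first by rewrite /gen_of /= -eqju.
  by apply: (@lexval_pullback _ b0 0%N) lt_us; rewrite ?size_word ?take0.
- split=> [n|m n phi [f phif] x Wx]; first exact: vic_mem_submod.
  by rewrite phif; apply: vic_mem_map.
move=> L LW Lgen.
pose L' := [seq existT (fun M => V M : Type) (Zn (tag g)) (tagged g) | g <- L].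
exists L'.
  by move=> g /List.in_map_iff[h [<- /LW]].
move=> n hn dn x Wx.
pose n' : rk := exist _ n dn.
rewrite (bool_irrelevance hn (rk_ge3 n')) in x Wx *.
apply: (Lgen (fun n => @generated R V L' (Zn n)) _ _ n' x Wx).
  split=> [i|i j phi [f phif] y]; first exact: generated_submod.
  by rewrite phif; apply: generated_map.
move=> g gL; have := @generated_gen R V L' (existT (fun M => V M : Type) (Zn (tag g)) (tagged g)).
by apply; apply/List.in_map_iff; exists g.
Qed.
End HighRank.

Theorem corollary4p5 (R : comPzRingType) (noethR : noetherian R)
  (V : vic_module R) (fgV : fg_vic_module V) (pfgV : pointwise_fg V)
  (pftV : pointwise_finite_type V) (W : vic_submodule V) :
  fg_vic_submodule W.
Proof.
have [d [hd [k [v vP]]]] := fg_common_rank fgV.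
have [l l_gt0 lP] := finite_type_fixed_by_unipotents hd pftV.
have Dl : ((l ^ 2).-1.+1%:Z = l%:R ^+ 2)%R.
  by rewrite prednK ?expn_gt0 ?l_gt0 // -natz natrX.
have [||L LW Lgen] := @fg_high_rank R noethR V d hd k v (l ^ 2).-1 _ _ W.
- by move=> n hn d3n; apply: vP; apply: leq_trans d3n; rewrite leq_pmull.
- by move=> n hn F F' G G' d3n GF GF'; rewrite Dl => FA GC;
     apply: (congruent_act lP).
(* Generators for the finitely many ranks below [b], rank by rank. *)
have low b : exists2 L, forall g, List.In g L -> W (tag g) (tagged g) &
    forall n (hn : (3 <= n)%N), (n < b)%N ->
      forall x : V (vic_Zn hn), W _ x -> generated L x.
  elim: b => [|b [L' L'W L'gen]]; first by exists [::].
  have [hb|] := boolP (3 <= b)%N; last first.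
    move=> b3; exists L' => // n hn; rewrite ltnS leq_eqVlt.
    by case/orP=> [/eqP nb|nb]; [case/negP: b3; rewrite -nb | exact: L'gen].
  have [L1 L1W L1gen] := submodule_generators noethR (pfgV b hb) (vic_mem_submod W (vic_Zn hb)).
  pose L2 := [seq existT (fun M => V M : Type) (vic_Zn hb) w | w <- L1].
  exists (L2 ++ L').
    move=> g /List.in_app_iff[/List.in_map_iff[w [<- /L1W]]//|]; exact: L'W.
  move=> n hn; rewrite ltnS leq_eqVlt => /orP[/eqP nb|nb] x Wx; last first.
    by apply: generated_incl (L'gen _ _ nb _ Wx); apply: List.incl_appr => ?.
  case: _ / (esym nb) in hn x Wx *.
  move: x Wx; rewrite (bool_irrelevance hn hb) => x Wx.
  apply: L1gen Wx => [|w wL1]; first exact: generated_submod.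
  apply: (generated_gen (g := existT (fun M => V M : Type) (vic_Zn hb) w)).
  by apply/List.in_app_iff; left; apply/List.in_map_iff; exists w.
have [L' L'W L'gen] := low (3 * d)%N.
apply: (generated_fg (L := L ++ L')).
  by move=> g /List.in_app_iff[]; [apply: LW | apply: L'W].
move=> M x Wx; rewrite -[x]to_ZnK; apply: generated_map.
have [dM|Md] := leqP (3 * d) (dim M).
  apply: generated_incl (Lgen _ (vic_rank M) dM _ (vic_mem_map _ Wx)).
  exact: List.incl_appl (List.incl_refl _).
apply: generated_incl (L'gen _ (vic_rank M) Md _ (vic_mem_map _ Wx)).
exact: List.incl_appr (List.incl_refl _).
Qed.
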